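(* Let $q\in\mathbb{C}\setminus\{0\}$ be not a root of unity. The $\mathbb{Z}_2^2$-bialgebra $\mathcal{A}_q(x,x^{-1},\xi,\theta,z)$ of polynomials on the extended double-graded quantum superplane can be made into a cocommutative and involutive Hopf $\mathbb{Z}_2^2$-algebra by defining an antipode $\mathcal{S}$ in the following way: $$\mathcal{S}(x)=x^{-1},\quad \mathcal{S}(x^{-1})=x,\quad \mathcal{S}(\xi)=-x^{-1}\xi x^{-1},\quad \mathcal{S}(\theta)=-x^{-1}\theta x^{-1},\quad \mathcal{S}(z)=-x^{-1}zx^{-1}.$$
   Context: The base field is $\mathbb{C}$, $\mathbb{Z}_2^2=\mathbb{Z}_2\times\mathbb{Z}_2$, and $\langle(a,b),(a',b')\rangle=aa'+bb'$. $\mathcal{A}=\mathcal{A}_q(x,x^{-1},\xi,\theta,z)$ is the $\mathbb{Z}_2^2$-graded, associative, unital algebra generated by $x,x^{-1},\xi,\theta,z$ of degrees $\deg x=\deg x^{-1}=(0,0)$, $\deg\xi=(0,1)$, $\deg\theta=(1,0)$, $\deg z=(1,1)$, subject to the relations $$x\xi=q\,\xi x,\quad x\theta=q\,\theta x,\quad xz=zx,\quad \xi^2=0,\quad \theta^2=0,\quad \xi\theta=\theta\xi,\quad \xi z=-q^{-1}z\xi,\quad \theta z=-q^{-1}z\theta,$$ $$xx^{-1}=x^{-1}x=1,\quad x^{-1}\xi=q^{-1}\xi x^{-1},\quad x^{-1}\theta=q^{-1}\theta x^{-1},\quad x^{-1}z=zx^{-1}.$$ The tensor product of $\mathbb{Z}_2^2$-graded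 algebras is the graded one: $(a\otimes b)(c\otimes d)=(-1)^{\langle\deg b,\deg c\rangle}ac\otimes bd$. The $\mathbb{Z}_2^2$-bialgebra structure on $\mathcal{A}$ is given by the algebra morphisms $\Delta:\mathcal{A}\to\mathcal{A}\otimes\mathcal{A}$ and $\epsilon:\mathcal{A}\to\mathbb{C}$ determined by $$\Delta(x)=x\otimes x,\quad\Delta(x^{-1})=x^{-1}\otimes x^{-1},\quad \Delta(y)=x\otimes y+y\otimes x\ \text{ for } y\in\{\xi,\theta,z\},$$ $$\epsilon(x)=\epsilon(x^{-1})=1,\quad \epsilon(\xi)=\epsilon(\theta)=\epsilon(z)=0.$$ A $\mathbb{Z}_2^2$-bialgebra is a $\mathbb{Z}_2^2$-graded associative unital algebra with multiplication $\mu$ and unit $\eta:\mathbb{C}\to\mathcal{A}$, together with grading-preserving maps $\Delta,\epsilon$ that are coassociative and counital and are morphisms of unital algebras (with respect to the graded tensor product). A Hopf $\mathbb{Z}_2^2$-algebra is a $\mathbb{Z}_2^2$-bialgebra admitting an antipode, i.e. a $\mathbb{Z}_2^2$-algebra antihomomorphism $\mathcal{S}:\mathcal{A}\to\mathcal{A}$, meaning $\mathcal{S}(ab)=(-1)^{\langle\deg a,\deg b\rangle}\mathcal{S}(b)\mathcal{S}(a)$ for homogeneous $a,b$, satisfying $\mu\circ(\mathcal{S}\otimes\mathrm{Id})\circ\Delta=\mu\circ(\mathrm{Id}\otimes\mathcal{S})\circ\Delta=\eta\circ\epsilon$. It is cocommutative if $\sigma\circ\Delta=\Delta$, where $\sigma(a\otimes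 b)=(-1)^{\langle\deg a,\deg b\rangle}b\otimes a$, and involutive if $\mathcal{S}^2=\mathrm{Id}$. *)

(* Defs.v *)
From HB Require Import structures.
From mathcomp Require Import all_boot all_order all_algebra.
From mathcomp Require Import sesquilinear.
From mathcomp Require Import boolp classical_sets reals complex.

Set Implicit Arguments.
Unset Strict Implicit.
Unset Printing Implicit Defensive.

Import GRing.Theory.
Local Open Scope ring_scope.
Local Open Scope quotient_scope.

Reserved Notation "x ⊗ y" (at level 40, left associativity).

Definition Z22 : Type := ('Z_2 * 'Z_2)%type.
HB.instance Definition _ := Finite.on Z22.
HB.instance Definition _ := GRing.Zmodule.on Z22.

Definition pairing (g h : Z22) : 'Z_2 := g.1 * h.1 + g.2 * h.2.

(* The exponent is the representative 0 or 1 of the pairing. *)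
Definition ksign (K : pzRingType) (g h : Z22) : K := (-1) ^+ (pairing g h : nat).

Section KSign.
Variable K : comPzRingType.
Implicit Types g h k : Z22.

Lemma signZ2D (a b : 'Z_2) :
  (-1 : K) ^+ ((a + b)%R : nat) = (-1) ^+ (a : nat) * (-1) ^+ (b : nat).
Proof.
by case: a => [[|[|//]] ?]; case: b => [[|[|//]] ?];
  rewrite /= ?expr0 ?expr1 ?mul1r ?mulr1 ?mulrNN ?mulr1.
Qed.

Lemma pairingC g h : pairing g h = pairing h g.
Proof. by rewrite /pairing mulrC [g.2 * _]mulrC. Qed.

Lemma pairingDl g g' h : pairing (g + g') h = pairing g h + pairing g' h.
Proof. by rewrite /pairing !mulrDl addrACA. Qed.

Lemma ksignC g h : ksign K g h = ksign K h g.
Proof. by rewrite /ksign pairingC. Qed.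

Lemma ksignDl g g' h : ksign K (g + g') h = ksign K g h * ksign K g' h.
Proof. by rewrite /ksign pairingDl signZ2D. Qed.

Lemma ksignDr g h h' : ksign K g (h + h') = ksign K g h * ksign K g h'.
Proof. by rewrite ksignC ksignDl !(ksignC g). Qed.

Lemma ksign0l g : ksign K 0 g = 1.
Proof. by rewrite /ksign /pairing !mul0r addr0 expr0. Qed.

Lemma ksign0r g : ksign K g 0 = 1.
Proof. by rewrite ksignC ksign0l. Qed.

Lemma ksignK g h : ksign K g h * ksign K g h = 1.
Proof. by rewrite /ksign -expr2 sqrr_sign. Qed.

End KSign.

(* A grading is given by the projections onto the summands A_g of the direct   *)
(* sum decomposition; thus A_g = {a | gproj g a = a}.                          *)
HB.mixin Record Algebra_isZ22Graded (K : fieldType) A of GRing.Algebra K A := {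
  gproj : Z22 -> A -> A;
  gproj_is_linear : forall g, linear (gproj g);
  sum_gproj : forall a, \sum_(g : Z22) gproj g a = a;
  gproj_gproj : forall g h a,
    gproj g (gproj h a) = if g == h then gproj h a else 0;
  gproj1 : gproj 0 1 = 1;
  gprojM : forall g h a b,
    gproj (g + h) (gproj g a * gproj h b) = gproj g a * gproj h b
}.
#[short(type="z22AlgType")]
HB.structure Definition Z22Alg (K : fieldType) :=
  {A of GRing.Algebra K A & Algebra_isZ22Graded K A}.

HB.instance Definition _ (K : fieldType) (A : z22AlgType K) (g : Z22) :=
  GRing.isLinear.Build K A A _ (@gproj K A g) (@gproj_is_linear K A g).

Definition homog (K : fieldType) (A : z22AlgType K) (g : Z22) (a : A) : Prop :=
  gproj g a = a.

(* The base field, concentrated in degree 0. *)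
Section BaseField.
Variable K : fieldType.

Definition base_proj (g : Z22) (k : K^o) : K^o := if g == 0 then k else 0.

Fact base_proj_linear g : linear (base_proj g).
Proof. by rewrite /base_proj => k a b; case: eqP; rewrite // scaler0 addr0. Qed.

Fact sum_base_proj k : \sum_(g : Z22) base_proj g k = k.
Proof.
rewrite (bigD1 (0 : Z22)) //= /base_proj eqxx big1 ?addr0 // => g.
by move/negPf ->.
Qed.

Fact base_proj_proj g h k :
  base_proj g (base_proj h k) = if g == h then base_proj h k else 0.
Proof.
rewrite /base_proj; case: (eqVneq g h) => [->|]; first by case: eqP.
by case: (eqVneq h 0) => [-> /negPf->|_ _] //; case: ifP.
Qed.

Fact base_proj1 : base_proj 0 1 = 1.
Proof. by rewrite /base_proj eqxx. Qed.

Fact base_projM g h a b :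
  base_proj (g + h) (base_proj g a * base_proj h b) = base_proj g a * base_proj h b.
Proof.
rewrite /base_proj; case: (eqVneq g 0) => [->|_]; last by rewrite mul0r; case: ifP.
rewrite add0r; case: (eqVneq h 0) => // _; by rewrite mulr0.
Qed.

HB.instance Definition _ := Algebra_isZ22Graded.Build K K^o
  base_proj_linear sum_base_proj base_proj_proj base_proj1 base_projM.

End BaseField.

(* U ⊗ V is presented by the generators u ⊗ v, subject to bilinearity.         *)
Section Tensor.
Variables (K : fieldType) (U V : lmodType K).

Inductive tterm : Type :=
| TPure (u : U) (v : V)
| TZero
| TAdd (s t : tterm)
| TOpp (t : tterm)
| TScale (k : K) (t : tterm).

HB.instance Definition _ := gen_eqMixin tterm.
HB.instance Definition _ := gen_choiceMixin tterm.

Inductive tcong : tterm -> tterm -> Prop :=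
| tcong_refl t : tcong t t
| tcong_sym s t : tcong s t -> tcong t s
| tcong_trans r s t : tcong r s -> tcong s t -> tcong r t
| tcong_add s s' t t' : tcong s s' -> tcong t t' ->
    tcong (TAdd s t) (TAdd s' t')
| tcong_opp t t' : tcong t t' -> tcong (TOpp t) (TOpp t')
| tcong_scale k t t' : tcong t t' -> tcong (TScale k t) (TScale k t')
| tcong_addA r s t : tcong (TAdd r (TAdd s t)) (TAdd (TAdd r s) t)
| tcong_addC s t : tcong (TAdd s t) (TAdd t s)
| tcong_add0 t : tcong (TAdd TZero t) t
| tcong_addN t : tcong (TAdd (TOpp t) t) TZero
| tcong_scaleA k l t : tcong (TScale k (TScale l t)) (TScale (k * l) t)
| tcong_scale1 t : tcong (TScale 1 t) t
| tcong_scaleDr k s t :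
    tcong (TScale k (TAdd s t)) (TAdd (TScale k s) (TScale k t))
| tcong_scaleDl k l t :
    tcong (TScale (k + l) t) (TAdd (TScale k t) (TScale l t))
| tcong_pureDl u u' v : tcong (TPure (u + u') v) (TAdd (TPure u v) (TPure u' v))
| tcong_pureDr u v v' : tcong (TPure u (v + v')) (TAdd (TPure u v) (TPure u v'))
| tcong_pureZl k u v : tcong (TPure (k *: u) v) (TScale k (TPure u v))
| tcong_pureZr k u v : tcong (TPure u (k *: v)) (TScale k (TPure u v)).

Definition tcongb : rel tterm := fun s t => `[< tcong s t >].

Fact tcongb_equiv : equiv_class_of tcongb.
Proof.
split=> [t|s t|s r t]; first by apply/asboolP; exact: tcong_refl.
  by apply/asboolP/asboolP; exact: tcong_sym.
by move=> /asboolP rs /asboolP st; apply/asboolP; exact: tcong_trans rs st.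
Qed.
Canonical tcongb_equivRel := EquivRelPack tcongb_equiv.

Definition tensor : Type := {eq_quot tcongb}.
HB.instance Definition _ := Choice.on tensor.
HB.instance Definition _ := Quotient.on tensor.

Definition tclass (t : tterm) : tensor := \pi_tensor t.

Lemma tclassP s t : tclass s = tclass t <-> tcong s t.
Proof. by split=> [/eqmodP/asboolP|st] //; apply/eqmodP/asboolP. Qed.

Lemma tclass_repr (a : tensor) : tclass (repr a) = a.
Proof. exact: reprK. Qed.

Lemma repr_tclass t : tcong (repr (tclass t)) t.
Proof. by apply/tclassP; rewrite tclass_repr. Qed.

Lemma tclassW (P : tensor -> Prop) : (forall t, P (tclass t)) -> forall a, P a.
Proof. by move=> Pt a; rewrite -(tclass_repr a). Qed.

Definition tens_add (a b : tensor) := tclass (TAdd (repr a) (repr b)).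
Definition tens_opp (a : tensor) := tclass (TOpp (repr a)).
Definition tens_scale k (a : tensor) := tclass (TScale k (repr a)).
Definition pure u v := tclass (TPure u v).

Lemma tclassD s t : tens_add (tclass s) (tclass t) = tclass (TAdd s t).
Proof. by apply/tclassP/tcong_add; exact: repr_tclass. Qed.

Lemma tclassN t : tens_opp (tclass t) = tclass (TOpp t).
Proof. by apply/tclassP/tcong_opp; exact: repr_tclass. Qed.

Lemma tclassZ k t : tens_scale k (tclass t) = tclass (TScale k t).
Proof. by apply/tclassP/tcong_scale; exact: repr_tclass. Qed.

Fact tens_addA : associative tens_add.
Proof.
elim/tclassW=> r; elim/tclassW=> s; elim/tclassW=> t.
by rewrite !tclassD; apply/tclassP/tcong_addA.
Qed.

Fact tens_addC : commutative tens_add.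
Proof.
elim/tclassW=> s; elim/tclassW=> t.
by rewrite !tclassD; apply/tclassP/tcong_addC.
Qed.

Fact tens_add0 : left_id (tclass TZero) tens_add.
Proof. by elim/tclassW=> t; rewrite tclassD; apply/tclassP/tcong_add0. Qed.

Fact tens_addN : left_inverse (tclass TZero) tens_opp tens_add.
Proof. by elim/tclassW=> t; rewrite tclassN tclassD; apply/tclassP/tcong_addN. Qed.

HB.instance Definition _ :=
  GRing.isZmodule.Build tensor tens_addA tens_addC tens_add0 tens_addN.

Lemma tens_addE (a b : tensor) : a + b = tens_add a b. Proof. by []. Qed.

Fact tens_scaleA k l a : tens_scale k (tens_scale l a) = tens_scale (k * l) a.
Proof. by elim/tclassW: a => t; rewrite !tclassZ; apply/tclassP/tcong_scaleA. Qed.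

Fact tens_scale1 : left_id 1 tens_scale.
Proof. by elim/tclassW=> t; rewrite tclassZ; apply/tclassP/tcong_scale1. Qed.

Fact tens_scaleDr : right_distributive tens_scale +%R.
Proof.
move=> k; elim/tclassW=> s; elim/tclassW=> t.
rewrite !tens_addE tclassD !tclassZ tclassD; exact/tclassP/tcong_scaleDr.
Qed.

Fact tens_scaleDl a : {morph tens_scale^~ a : k l / k + l}.
Proof.
elim/tclassW: a => t k l; rewrite !tens_addE !tclassZ tclassD.
exact/tclassP/tcong_scaleDl.
Qed.

HB.instance Definition _ := GRing.Zmodule_isLmodule.Build K tensor
  tens_scaleA tens_scale1 tens_scaleDr tens_scaleDl.

Lemma tens_scaleE k (a : tensor) : k *: a = tens_scale k a. Proof. by []. Qed.

Lemma pureDl u u' v : pure (u + u') v = pure u v + pure u' v.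
Proof. by rewrite tens_addE tclassD; apply/tclassP/tcong_pureDl. Qed.

Lemma pureDr u v v' : pure u (v + v') = pure u v + pure u v'.
Proof. by rewrite tens_addE tclassD; apply/tclassP/tcong_pureDr. Qed.

Lemma pureZl k u v : pure (k *: u) v = k *: pure u v.
Proof. by rewrite tens_scaleE tclassZ; apply/tclassP/tcong_pureZl. Qed.

Lemma pureZr k u v : pure u (k *: v) = k *: pure u v.
Proof. by rewrite tens_scaleE tclassZ; apply/tclassP/tcong_pureZr. Qed.

Fact pure_bilinear : bilinear_for *:%R *:%R pure.
Proof. by split=> [v|u] k a b; rewrite ?pureDl ?pureDr ?pureZl ?pureZr. Qed.
HB.instance Definition _ :=
  bilinear_isBilinear.Build K U V tensor *:%R *:%R pure pure_bilinear.

Lemma tensW (P : tensor -> Prop) :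
    (forall u v, P (pure u v)) -> P 0 -> (forall a b, P a -> P b -> P (a + b)) ->
    (forall k a, P a -> P (k *: a)) -> forall a, P a.
Proof.
move=> Pp P0 PD PZ; elim/tclassW; elim=> [u v||s Ps t Pt|t Pt|k t Pt].
- exact: Pp.
- exact: P0.
- by rewrite -tclassD; exact: PD.
- by rewrite -tclassN; have := PZ (-1) _ Pt; rewrite scaleN1r.
- by rewrite -tclassZ; exact: PZ.
Qed.

Section Lift.
Variables (W : lmodType K) (f : {bilinear U -> V -> W}).

Fixpoint teval (t : tterm) : W :=
  match t with
  | TPure u v => f u v
  | TZero => 0
  | TAdd s t => teval s + teval t
  | TOpp t => - teval t
  | TScale k t => k *: teval t
  end.

Lemma tevalP s t : tcong s t -> teval s = teval t.
Proof.
elim=> //= *; rewrite ?linearDl ?linearDr ?linearZl_LR ?linearZr_LR //.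
- by congruence.
- by congruence.
- by congruence.
- by congruence.
- by rewrite addrA.
- by rewrite addrC.
- by rewrite add0r.
- by rewrite addNr.
- by rewrite scalerA.
- by rewrite scale1r.
- by rewrite scalerDr.
- by rewrite scalerDl.
Qed.

Definition tlift (a : tensor) : W := teval (repr a).

Lemma tlift_class t : tlift (tclass t) = teval t.
Proof. by apply/tevalP/repr_tclass. Qed.

Lemma tlift_pure u v : tlift (pure u v) = f u v.
Proof. exact: tlift_class. Qed.

Fact tlift_linear : linear tlift.
Proof.
move=> k; elim/tclassW=> s; elim/tclassW=> t.
by rewrite tens_addE tens_scaleE tclassZ tclassD !tlift_class.
Qed.
HB.instance Definition _ := GRing.isLinear.Build K tensor W _ tlift tlift_linear.

End Lift.

Lemma tens_ext (W : lmodType K) (f g : {linear tensor -> W}) :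
  (forall u v, f (pure u v) = g (pure u v)) -> f =1 g.
Proof.
move=> fg; elim/tensW=> [u v||a b fa fb|k a fa] //; first by rewrite !linear0.
  by rewrite !linearD fa fb.
by rewrite !linearZ fa.
Qed.

End Tensor.

Notation "U ⊗ V" := (tensor U%type V%type) : type_scope.
Notation "u ⊗ v" := (pure u v) : ring_scope.

Lemma ex_functional (K : fieldType) (V : lmodType K) (v : V) : v != 0 ->
  exists2 f : {linear V -> K^o}, True & f v = 1.
Proof.
move=> v0.
pose sub (A : set V) := (forall k a b, A a -> A b -> A (k *: a + b)) /\ ~ A v.
have [A [[Alin Av] Amax]] : exists A, sub A /\ forall B, (A `<` B)%classic -> ~ sub B.
  apply: Zorn_bigcup => F FP Ftot; split; last by case=> X /FP [].
  move=> k a b [X FX Xa] [Y FY Yb].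
  have [XY|YX] := Ftot _ _ FX FY.
    by exists Y => //; apply: (proj1 (FP _ FY)) => //; exact: XY.
  by exists X => //; apply: (proj1 (FP _ FX)) => //; exact: YX.
have A0 : A 0.
  apply: contrapT => nA0; apply: (Amax [set 0]%classic); last first.
    by split=> [k a b -> ->|/eqP]; [rewrite scaler0 addr0 | rewrite (negPf v0)].
  split=> [a Aa|/(_ 0 erefl)//].
  by case: nA0; rewrite -(addNr a) -scaleN1r; exact: Alin.
have AZ k a : A a -> A (k *: a) by move=> Aa; rewrite -[_ *: _]addr0; exact: Alin.
have AB a b : A a -> A b -> A (a - b).
  by move=> Aa Ab; rewrite addrC -scaleN1r; exact: Alin.
have ex x : exists k, A (x - k *: v).
  apply: contrapT => /forallNP nex.
  apply: (Amax [set y | exists c, A (y - c *: x)]%classic).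
    split=> [a Aa|]; first by exists 0; rewrite scale0r subr0.
    move=> /(_ x); apply: contra_not (nex 0); rewrite scale0r subr0; apply.
    by exists 1; rewrite scale1r subrr.
  split=> [k a b [c Ac] [d Ad]|[c Ac]].
    exists (k * c + d); rewrite scalerDl -scalerA opprD addrACA -scalerBr.
    exact: Alin.
  have c0 : c != 0 by apply: contra_notN Av => /eqP c0; move: Ac; rewrite c0 scale0r subr0.
  apply: (nex c^-1); have := AZ (- c^-1) _ Ac.
  by rewrite scalerBr scalerA mulNr mulVf // !scaleNr scale1r opprK addrC.
have uniq x k l : A (x - k *: v) -> A (x - l *: v) -> k = l.
  move=> Ak Al; apply/eqP; rewrite -subr_eq0; apply/negP => kl; apply: Av.
  have := AZ (k - l)^-1 _ (AB _ _ Al Ak).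
  have -> : x - l *: v - (x - k *: v) = (k - l) *: v.
    by rewrite opprB [LHS]addrC addrA subrK scalerBl.
  by rewrite scalerA mulVf ?scale1r //; exact/negP.
have [f fP] := choice ex.
have flin : linear (f : V -> K^o).
  move=> k a b; apply: (uniq (k *: a + b)); first exact: fP.
  rewrite scalerDl -scalerA opprD addrACA -scalerBr; exact/Alin.
pose F : {linear V -> K^o} := HB.pack (f : V -> K^o) (GRing.isLinear.Build K V K^o _ _ flin).
exists F => //=; apply: (uniq v); first exact: fP.
by rewrite scale1r subrr.
Qed.

Section BilinearScalar.
Variables (K : fieldType) (U V : lmodType K).
Variables (f : {linear U -> K^o}) (g : {linear V -> K^o}).
Definition prodf u v : K^o := f u * g v.
Fact prodf_bilinear : bilinear_for *:%R *:%R prodf.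
Proof.
split=> [v|u] k a b; rewrite /prodf linearP.
  by rewrite mulrDl -scalerAl.
by rewrite mulrDr -scalerAr.
Qed.
HB.instance Definition _ :=
  bilinear_isBilinear.Build K U V K^o *:%R *:%R prodf prodf_bilinear.
End BilinearScalar.

Lemma pure_neq0 (K : fieldType) (U V : lmodType K) (u : U) (v : V) :
  u != 0 -> v != 0 -> u ⊗ v != 0.
Proof.
move=> /ex_functional [f _ fu] /ex_functional [g _ gv].
apply/eqP => uv0; have : tlift (prodf f g) (u ⊗ v) = f u * g v.
  exact: tlift_pure.
by rewrite uv0 linear0 fu gv mulr1 => /eqP; rewrite eq_sym oner_eq0.
Qed.

Section Homog.
Variables (K : fieldType) (A : z22AlgType K).
Implicit Types (a b : A) (g h : Z22).

Lemma homog_gproj g a : homog g (gproj g a).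
Proof. by rewrite /homog gproj_gproj eqxx. Qed.

Lemma gproj_homog g h a : homog h a -> gproj g a = if g == h then a else 0.
Proof. by move=> ha; rewrite -ha gproj_gproj ha. Qed.

Lemma homog1 : homog 0 (1 : A).
Proof. exact: gproj1. Qed.

Lemma homogM g h a b : homog g a -> homog h b -> homog (g + h) (a * b).
Proof. by rewrite /homog => ga hb; rewrite -{1}ga -{1}hb gprojM ga hb. Qed.

Lemma homogD g a b : homog g a -> homog g b -> homog g (a + b).
Proof. by move=> ga gb; rewrite /homog linearD /= ga gb. Qed.

Lemma homogZ g k a : homog g a -> homog g (k *: a).
Proof. by move=> ga; rewrite /homog linearZ /= ga. Qed.

End Homog.

Section GradedTensor.
Variables (K : fieldType) (A B : z22AlgType K).
Local Notation T := (tensor A B).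
Implicit Types (a c : A) (b d : B) (g h k : Z22) (s t : T).

Lemma htensW (P : T -> Prop) :
    (forall g h a b, homog g a -> homog h b -> P (a ⊗ b)) -> P 0 ->
    (forall s t, P s -> P t -> P (s + t)) -> (forall (x : K) t, P t -> P (x *: t)) ->
  forall t, P t.
Proof.
move=> Pp P0 PD PZ; apply: tensW => // a b.
rewrite -(sum_gproj a) -(sum_gproj b) linear_sumr.
elim/big_ind: _ => // h _; rewrite linear_sumlz; elim/big_ind: _ => // g _.
by apply: Pp; exact: homog_gproj.
Qed.

(* (a ⊗ b) * (c ⊗ d), obtained from the sign rule by decomposing b and c into  *)
(* homogeneous components.                                                     *)
Definition gmul4 a b c d : T :=
  \sum_(h : Z22) \sum_(k : Z22)
     ksign K h k *: ((a * gproj k c) ⊗ (gproj h b * d)).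

Definition gmul_left c d a b := gmul4 a b c d.
Fact gmul_left_bilinear c d : bilinear_for *:%R *:%R (gmul_left c d).
Proof.
split=> [b|a] x y z /=; rewrite /gmul_left /gmul4 scaler_sumr -big_split /=;
  apply: eq_bigr => h _; rewrite scaler_sumr -big_split /=;
  apply: eq_bigr => k _; rewrite scalerA mulrC -scalerA -scalerDr; congr (_ *: _).
  by rewrite mulrDl -scalerAl pureDl pureZl.
by rewrite linearP mulrDl -scalerAl pureDr pureZr.
Qed.
HB.instance Definition _ c d := bilinear_isBilinear.Build K A B T *:%R *:%R
  (gmul_left c d) (gmul_left_bilinear c d).

Definition gmul_right t c d : T := tlift (gmul_left c d) t.
Fact gmul_rightPl (x : K) t d c c' : gmul_right t (x *: c + c') d =
  x *: gmul_right t c d + gmul_right t c' d.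
Proof.
rewrite /gmul_right; elim/tensW: t => [a b||s t IH IH'|k t IH].
- rewrite !tlift_pure /gmul_left /gmul4 scaler_sumr -big_split /=.
  apply: eq_bigr => h _; rewrite scaler_sumr -big_split /=.
  apply: eq_bigr => k _; rewrite scalerA mulrC -scalerA -scalerDr; congr (_ *: _).
  by rewrite linearP mulrDr -scalerAr pureDl pureZl.
- by rewrite !linear0 ?scaler0 addr0.
- by rewrite !linearD /= IH IH' ?scalerDr addrACA.
- by rewrite !linearZ /= IH scalerDr !scalerA mulrC.
Qed.

Fact gmul_rightPr (x : K) t c d d' : gmul_right t c (x *: d + d') =
  x *: gmul_right t c d + gmul_right t c d'.
Proof.
rewrite /gmul_right; elim/tensW: t => [a b||s t IH IH'|k t IH].
- rewrite !tlift_pure /gmul_left /gmul4 scaler_sumr -big_split /=.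
  apply: eq_bigr => h _; rewrite scaler_sumr -big_split /=.
  apply: eq_bigr => k _; rewrite scalerA mulrC -scalerA -scalerDr; congr (_ *: _).
  by rewrite mulrDr -scalerAr pureDr pureZr.
- by rewrite !linear0 ?scaler0 addr0.
- by rewrite !linearD /= IH IH' ?scalerDr addrACA.
- by rewrite !linearZ /= IH scalerDr !scalerA mulrC.
Qed.

Fact gmul_right_bilinear t : bilinear_for *:%R *:%R (gmul_right t).
Proof. by split=> [d|c] x y z; [exact: gmul_rightPl | exact: gmul_rightPr]. Qed.
HB.instance Definition _ t := bilinear_isBilinear.Build K A B T *:%R *:%R
  (gmul_right t) (gmul_right_bilinear t).

Definition gmul s t : T := tlift (gmul_right s) t.

Lemma gmul_pure a b c d : gmul (a ⊗ b) (c ⊗ d) = gmul4 a b c d.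
Proof.
have -> : gmul (a ⊗ b) (c ⊗ d) = gmul_right (a ⊗ b) c d by exact: tlift_pure.
by exact: tlift_pure.
Qed.

Lemma gmul_homog h k a b c d : homog h b -> homog k c ->
  gmul (a ⊗ b) (c ⊗ d) = ksign K h k *: ((a * c) ⊗ (b * d)).
Proof.
move=> hb kc; rewrite gmul_pure /gmul4 (bigD1 h) //= [X in _ + X]big1 ?addr0; last first.
  move=> h' /negPf nh; rewrite big1 // => k' _.
  by rewrite (gproj_homog h' hb) nh mul0r linear0r scaler0.
rewrite (bigD1 k) //= big1 ?addr0; last first.
  by move=> k' /negPf nk; rewrite (gproj_homog k' kc) nk mulr0 linear0l scaler0.
by rewrite hb kc.
Qed.

Lemma gmul_linearr s : linear (gmul s).
Proof. by move=> x y z; rewrite /gmul linearP. Qed.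

Lemma gmul_purer t c d : gmul t (c ⊗ d) = tlift (gmul_left c d) t.
Proof. exact: tlift_pure. Qed.

Lemma gmul_linearl t : linear (gmul^~ t).
Proof.
move=> x s s'; elim/tensW: t => [c d||t t'|y t].
- by rewrite !gmul_purer linearP.
- by rewrite /gmul !linear0 ?scaler0 addr0.
- by rewrite /gmul !linearD /= => -> ->; rewrite ?scalerDr addrACA.
- by rewrite /gmul !linearZ /= => ->; rewrite scalerDr !scalerA mulrC.
Qed.

Lemma gmulDr s : {morph gmul s : t t' / t + t'}.
Proof. by move=> t t'; rewrite -[t]scale1r gmul_linearr !scale1r. Qed.
Lemma gmulDl t : {morph gmul^~ t : s s' / s + s'}.
Proof. by move=> s s'; rewrite -[s]scale1r gmul_linearl !scale1r. Qed.
Lemma gmul0r s : gmul s 0 = 0.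
Proof. by apply: (addrI (gmul s 0)); rewrite -gmulDr !addr0. Qed.
Lemma gmul0l t : gmul 0 t = 0.
Proof. by apply: (addrI (gmul 0 t)); rewrite -gmulDl !addr0. Qed.
Lemma gmulZr s x t : gmul s (x *: t) = x *: gmul s t.
Proof. by rewrite -[x *: t]addr0 gmul_linearr gmul0r addr0. Qed.
Lemma gmulZl x s t : gmul (x *: s) t = x *: gmul s t.
Proof. by rewrite -[x *: s]addr0 gmul_linearl gmul0l addr0. Qed.

Fact gmulA : associative gmul.
Proof.
move=> r s t; elim/htensW: r => [h1 k1 a b ha hb||r r' IH IH'|x r IH].
- elim/htensW: s => [h2 k2 c d hc hd||s s' IH IH'|x s IH].
  + elim/htensW: t => [h3 k3 e f he hf||t t' IH IH'|x t IH].
    * rewrite (gmul_homog _ _ hd he) (gmul_homog _ _ hb hc) gmulZr gmulZl.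
      rewrite (gmul_homog _ _ hb (homogM hc he)) (gmul_homog _ _ (homogM hb hd) he).
      by rewrite !scalerA !mulrA ksignDr ksignDl; congr (_ *: _); rewrite mulrC -mulrA.
    * by rewrite !gmul0r.
    * by rewrite !gmulDr IH IH'.
    * by rewrite !gmulZr IH.
  + by rewrite gmul0l !gmul0r gmul0l.
  + by rewrite gmulDl !gmulDr gmulDl IH IH'.
  + by rewrite gmulZl !gmulZr gmulZl IH.
- by rewrite !gmul0l.
- by rewrite !gmulDl IH IH'.
- by rewrite !gmulZl IH.
Qed.

Fact gmul1l : left_id (1 ⊗ 1) gmul.
Proof.
elim/htensW=> [g h a b ga hb||s t IH IH'|x t IH].
- by rewrite (gmul_homog _ _ (homog1 B) ga) ksign0l scale1r !mul1r.
- exact: gmul0r.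
- by rewrite gmulDr IH IH'.
- by rewrite gmulZr IH.
Qed.

Fact gmul1r : right_id (1 ⊗ 1) gmul.
Proof.
elim/htensW=> [g h a b ga hb||s t IH IH'|x t IH].
- by rewrite (gmul_homog _ _ hb (homog1 A)) ksign0r scale1r !mulr1.
- exact: gmul0l.
- by rewrite gmulDl IH IH'.
- by rewrite gmulZl IH.
Qed.

Fact gmul_Dl : left_distributive gmul +%R.
Proof. by move=> r s t; exact: gmulDl. Qed.
Fact gmul_Dr : right_distributive gmul +%R.
Proof. by move=> r s t; exact: gmulDr. Qed.
Fact tens1_neq0 : (1 : A) ⊗ (1 : B) != 0.
Proof. by apply: pure_neq0; exact: oner_neq0. Qed.

HB.instance Definition _ := GRing.Zmodule_isNzRing.Build (tensor A B)
  gmulA gmul1l gmul1r gmul_Dl gmul_Dr tens1_neq0.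

Fact gmul_scalerAl x s t : x *: (s * t) = (x *: s) * t.
Proof. by rewrite -gmulZl. Qed.
HB.instance Definition _ :=
  GRing.Lmodule_isLalgebra.Build K (tensor A B) gmul_scalerAl.
Fact gmul_scalerAr x s t : x *: (s * t) = s * (x *: t).
Proof. by rewrite -gmulZr. Qed.
HB.instance Definition _ :=
  GRing.Lalgebra_isAlgebra.Build K (tensor A B) gmul_scalerAr.

Definition tproj_pure g a b : T :=
  \sum_(h : Z22) gproj h a ⊗ gproj (g - h) b.
Fact tproj_pure_bilinear g : bilinear_for *:%R *:%R (tproj_pure g).
Proof.
split=> [b|a] x y z /=; rewrite /tproj_pure scaler_sumr -big_split /=;
  apply: eq_bigr => h _; rewrite linearP.
  by rewrite pureDl pureZl.
by rewrite pureDr pureZr.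
Qed.
HB.instance Definition _ g := bilinear_isBilinear.Build K A B T *:%R *:%R
  (tproj_pure g) (tproj_pure_bilinear g).

Definition tproj g : T -> T := tlift (tproj_pure g).
HB.instance Definition _ g := GRing.Linear.copy (tproj g) (tlift (tproj_pure g)).

Lemma tproj_homog g h k a b : homog h a -> homog k b ->
  tproj g (a ⊗ b) = if g == h + k then a ⊗ b else 0.
Proof.
move=> ha kb.
have -> : tproj g (a ⊗ b) = tproj_pure g a b by exact: tlift_pure.
rewrite /tproj_pure (bigD1 h) //= big1 ?addr0.
  rewrite ha (gproj_homog _ kb) subr_eq addrC; case: eqP => // _.
  by rewrite linear0r.
by move=> h' /negPf nh; rewrite (gproj_homog _ ha) nh linear0l.
Qed.

Fact tproj_linear g : linear (tproj g).
Proof. by move=> x s t; rewrite linearP. Qed.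

Fact sum_tproj t : \sum_(g : Z22) tproj g t = t.
Proof.
elim/htensW: t => [h k a b ha kb||s t IH IH'|x t IH].
- rewrite (bigD1 (h + k)) //= (tproj_homog _ ha kb) eqxx big1 ?addr0 // => g.
  by rewrite (tproj_homog _ ha kb) => /negPf ->.
- by rewrite big1 // => g _; rewrite linear0.
- under eq_bigr do rewrite linearD; by rewrite big_split /= IH IH'.
- under eq_bigr do rewrite linearZ; by rewrite /= -scaler_sumr IH.
Qed.

Fact tproj_tproj g h t : tproj g (tproj h t) = if g == h then tproj h t else 0.
Proof.
elim/htensW: t => [h1 k a b ha kb||s t IH IH'|x t IH].
- rewrite (tproj_homog h ha kb); case: (eqVneq h (h1 + k)) => [->|_].
    by rewrite (tproj_homog g ha kb).
  by rewrite linear0; case: ifP.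
- by rewrite !linear0; case: ifP.
- by rewrite !linearD /= IH IH'; case: ifP; rewrite ?addr0.
- by rewrite !linearZ /= IH; case: ifP; rewrite ?scaler0.
Qed.

Fact tproj1 : tproj 0 (1 : T) = 1.
Proof. by rewrite (tproj_homog _ (homog1 A) (homog1 B)) addr0. Qed.

Fact tprojM g h s t : tproj (g + h) (tproj g s * tproj h t) = tproj g s * tproj h t.
Proof.
elim/htensW: s => [h1 k1 a b ha hb||s s' IH IH'|x s IH].
- elim/htensW: t => [h2 k2 c d hc hd||t t' IH IH'|x t IH].
  + rewrite (tproj_homog _ ha hb) (tproj_homog _ hc hd).
    case: eqP => [->|_]; last by rewrite mul0r linear0.
    case: eqP => [->|_]; last by rewrite mulr0 linear0.
    rewrite [_ * _](gmul_homog _ _ hb hc) linearZ /=.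
    by rewrite (tproj_homog _ (homogM ha hc) (homogM hb hd)) addrACA eqxx.
  + by rewrite !linear0 mulr0 linear0.
  + by rewrite !linearD /= mulrDr linearD /= IH IH'.
  + by rewrite !linearZ /= -scalerAr linearZ /= IH.
- by rewrite !linear0 mul0r linear0.
- by rewrite !linearD /= mulrDl linearD /= IH IH'.
- by rewrite !linearZ /= -scalerAl linearZ /= IH.
Qed.

HB.instance Definition _ := Algebra_isZ22Graded.Build K (tensor A B)
  tproj_linear sum_tproj tproj_tproj tproj1 tprojM.

Lemma tensM h k a b c d : homog h b -> homog k c ->
  (a ⊗ b) * (c ⊗ d) = ksign K h k *: ((a * c) ⊗ (b * d)).
Proof. exact: gmul_homog. Qed.

End GradedTensor.

Section TensorMaps.
Variables (K : fieldType) (U U' V V' W : lmodType K).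

Section TensMap.
Variables (f : {linear U -> U'}) (g : {linear V -> V'}).

Definition tmap_pure (u : U) (v : V) : U' ⊗ V' := f u ⊗ g v.
Fact tmap_pure_bilinear : bilinear_for *:%R *:%R tmap_pure.
Proof.
by split=> [v|u] k a b; rewrite /tmap_pure linearP ?pureDl ?pureZl ?pureDr ?pureZr.
Qed.
HB.instance Definition _ := bilinear_isBilinear.Build K U V (tensor U' V')
  *:%R *:%R tmap_pure tmap_pure_bilinear.

Definition tens_map : tensor U V -> tensor U' V' := tlift tmap_pure.
HB.instance Definition _ := GRing.Linear.copy tens_map (tlift tmap_pure).

Lemma tens_map_pure u v : tens_map (u ⊗ v) = f u ⊗ g v.
Proof. exact: tlift_pure. Qed.
End TensMap.

Section TensAssoc.
Definition tassoc_pure (w : W) (u : U) (v : V) : U ⊗ (V ⊗ W) := u ⊗ (v ⊗ w).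
Fact tassoc_pure_bilinear w : bilinear_for *:%R *:%R (tassoc_pure w).
Proof.
by split=> [v|u] k a b; rewrite /tassoc_pure ?pureDl ?pureZl // pureDr pureZr.
Qed.
HB.instance Definition _ w := bilinear_isBilinear.Build K U V
  (tensor U (tensor V W)) *:%R *:%R (tassoc_pure w) (tassoc_pure_bilinear w).

Definition tassoc_left (t : tensor U V) (w : W) : tensor U (tensor V W) :=
  tlift (tassoc_pure w) t.
Fact tassoc_leftPr (k : K) t w w' :
  tassoc_left t (k *: w + w') = k *: tassoc_left t w + tassoc_left t w'.
Proof.
rewrite /tassoc_left; elim/tensW: t => [u v||s t IH IH'|x t IH].
- by rewrite !tlift_pure /= /tassoc_pure pureDr pureZr pureDr pureZr.
- by rewrite !linear0 ?scaler0 addr0.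
- by rewrite !linearD /= IH IH' ?scalerDr addrACA.
- by rewrite !linearZ /= IH scalerDr !scalerA mulrC.
Qed.
Fact tassoc_left_bilinear : bilinear_for *:%R *:%R tassoc_left.
Proof. by split=> [w|t] x y z; [exact: linearP | exact: tassoc_leftPr]. Qed.
HB.instance Definition _ := bilinear_isBilinear.Build K (tensor U V) W
  (tensor U (tensor V W)) *:%R *:%R tassoc_left tassoc_left_bilinear.

Definition tens_assoc : tensor (tensor U V) W -> tensor U (tensor V W) :=
  tlift tassoc_left.
HB.instance Definition _ := GRing.Linear.copy tens_assoc (tlift tassoc_left).

Lemma tens_assoc_pure u v w : tens_assoc ((u ⊗ v) ⊗ w) = u ⊗ (v ⊗ w).
Proof.
have -> : tens_assoc ((u ⊗ v) ⊗ w) = tassoc_left (u ⊗ v) w by exact: tlift_pure.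
exact: tlift_pure.
Qed.
End TensAssoc.

End TensorMaps.

Section Multiplication.
Variables (K : fieldType) (A : algType K).

Definition mulf (a b : A) : A := a * b.
Fact mulf_bilinear : bilinear_for *:%R *:%R mulf.
Proof.
by split=> [v|u] k a b; rewrite /mulf ?mulrDl ?mulrDr -?scalerAl -?scalerAr.
Qed.
HB.instance Definition _ :=
  bilinear_isBilinear.Build K A A A *:%R *:%R mulf mulf_bilinear.

Definition tens_mul : tensor A A -> A := tlift mulf.
HB.instance Definition _ := GRing.Linear.copy tens_mul (tlift mulf).

Lemma tens_mul_pure a b : tens_mul (a ⊗ b) = a * b.
Proof. exact: tlift_pure. Qed.
End Multiplication.

Section Swap.
Variables (K : fieldType) (A B : z22AlgType K).

(* σ(a ⊗ b), obtained by decomposing a and b into homogeneous components.      *)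
Definition swap_pure (a : A) (b : B) : B ⊗ A :=
  \sum_(g : Z22) \sum_(h : Z22) ksign K g h *: (gproj h b ⊗ gproj g a).
Fact swap_pure_bilinear : bilinear_for *:%R *:%R swap_pure.
Proof.
split=> [b|a] x y z /=; rewrite /swap_pure scaler_sumr -big_split /=;
  apply: eq_bigr => g _; rewrite scaler_sumr -big_split /=;
  apply: eq_bigr => h _; rewrite scalerA mulrC -scalerA -scalerDr;
  by rewrite linearP ?pureDl ?pureZl ?pureDr ?pureZr.
Qed.
HB.instance Definition _ := bilinear_isBilinear.Build K A B (tensor B A)
  *:%R *:%R swap_pure swap_pure_bilinear.

Definition swap : tensor A B -> tensor B A := tlift swap_pure.
HB.instance Definition _ := GRing.Linear.copy swap (tlift swap_pure).

Lemma swap_homog g h a b : homog g a -> homog h b ->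
  swap (a ⊗ b) = ksign K g h *: (b ⊗ a).
Proof.
move=> ga hb; have -> : swap (a ⊗ b) = swap_pure a b by exact: tlift_pure.
rewrite /swap_pure (bigD1 g) //= [X in _ + X]big1 ?addr0; last first.
  move=> g' /negPf ng; rewrite big1 // => h' _.
  by rewrite (gproj_homog g' ga) ng linear0r scaler0.
rewrite (bigD1 h) //= big1 ?addr0; last first.
  by move=> h' /negPf nh; rewrite (gproj_homog h' hb) nh linear0l scaler0.
by rewrite ga hb.
Qed.
End Swap.

Section Hopf.
Variables (K : fieldType) (A : z22AlgType K).

Definition z22_morphism (B : z22AlgType K) (f : A -> B) : Prop :=
  monoid_morphism f /\ forall g a, homog g a -> homog g (f a).

Record z22_bialgebra (Delta : {linear A -> (A ⊗ A)%type}) (eps : {linear A -> K^o}) :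
    Prop := {
  comul_morphism : z22_morphism Delta;
  counit_morphism : z22_morphism eps;
  comulA : forall a, tens_assoc (tens_map Delta idfun (Delta a)) =
                     tens_map idfun Delta (Delta a);
  counitl : forall a, tens_map eps idfun (Delta a) = (1 : K^o) ⊗ a;
  counitr : forall a, tens_map idfun eps (Delta a) = a ⊗ (1 : K^o)
}.

Record z22_antihom (S : {linear A -> A}) : Prop := {
  antihom_homog : forall g a, homog g a -> homog g (S a);
  antihom1 : S 1 = 1;
  antihomM : forall g h a b, homog g a -> homog h b ->
    S (a * b) = ksign K g h *: (S b * S a)
}.

Record z22_antipode (Delta : {linear A -> (A ⊗ A)%type}) (eps : {linear A -> K^o})
    (S : {linear A -> A}) : Prop := {
  antipode_antihom : z22_antihom S;
  antipodel : forall a, tens_mul (tens_map S idfun (Delta a)) = (eps a : K)%:A;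
  antipoder : forall a, tens_mul (tens_map idfun S (Delta a)) = (eps a : K)%:A
}.

Definition z22_hopf (Delta : {linear A -> (A ⊗ A)%type}) (eps : {linear A -> K^o})
    (S : {linear A -> A}) : Prop :=
  z22_bialgebra Delta eps /\ z22_antipode Delta eps S.

Definition cocommutative (Delta : {linear A -> (A ⊗ A)%type}) : Prop :=
  forall a, swap (Delta a) = Delta a.

End Hopf.

(* Functions Z22 -> A under convolution, i.e. the group algebra A[Z22]; used   *)
(* to obtain the grading of a graded presentation.                             *)
Section GroupAlgebra.
Variables (K : fieldType) (A : algType K).

Definition grpalg : Type := {ffun Z22 -> A}.
HB.instance Definition _ := GRing.Lmodule.on grpalg.
Implicit Types (u v w : grpalg) (g h k : Z22).

Definition single g (a : A) : grpalg := [ffun k => if k == g then a else 0].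
Definition conv u v : grpalg := [ffun k => \sum_(h : Z22) u h * v (k - h)].

Fact convA : associative conv.
Proof.
move=> u v w; apply/ffunP => k; rewrite !ffunE.
under eq_bigr do rewrite ffunE mulr_sumr.
under [RHS]eq_bigr do rewrite ffunE mulr_suml.
rewrite [RHS]exchange_big /=; apply: eq_bigr => h _.
rewrite [RHS](reindex_inj (addrI h)) /=; apply: eq_bigr => l _.
by rewrite mulrA opprD addrA [h + l]addrC addrK.
Qed.

Fact conv1l : left_id (single 0 1) conv.
Proof.
move=> u; apply/ffunP => k; rewrite ffunE (bigD1 0) //= big1 => [|h /negPf nh].
  by rewrite ffunE eqxx mul1r subr0 addr0.
by rewrite ffunE nh mul0r.
Qed.

Fact conv1r : right_id (single 0 1) conv.
Proof.
move=> u; apply/ffunP => k; rewrite ffunE (bigD1 k) //= big1 => [|h /negPf nh].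
  by rewrite ffunE subrr eqxx mulr1 addr0.
by rewrite ffunE subr_eq0 eq_sym nh mulr0.
Qed.

Fact convDl : left_distributive conv +%R.
Proof.
move=> u v w; apply/ffunP => k; rewrite !ffunE -big_split /=.
by apply: eq_bigr => h _; rewrite ffunE mulrDl.
Qed.

Fact convDr : right_distributive conv +%R.
Proof.
move=> u v w; apply/ffunP => k; rewrite !ffunE -big_split /=.
by apply: eq_bigr => h _; rewrite ffunE mulrDr.
Qed.

Fact conv1_neq0 : single 0 1 != 0 :> grpalg.
Proof.
apply/eqP => /ffunP /(_ 0); rewrite !ffunE eqxx => /eqP.
by rewrite oner_eq0.
Qed.

HB.instance Definition _ := GRing.Zmodule_isNzRing.Build grpalg
  convA conv1l conv1r convDl convDr conv1_neq0.

Fact conv_scalerAl (x : K) u v : x *: (u * v) = (x *: u) * v.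
Proof.
apply/ffunP => k; rewrite !ffunE scaler_sumr; apply: eq_bigr => h _.
by rewrite ffunE scalerAl.
Qed.
HB.instance Definition _ := GRing.Lmodule_isLalgebra.Build K grpalg conv_scalerAl.

Fact conv_scalerAr (x : K) u v : x *: (u * v) = u * (x *: v).
Proof.
apply/ffunP => k; rewrite !ffunE scaler_sumr; apply: eq_bigr => h _.
by rewrite ffunE scalerAr.
Qed.
HB.instance Definition _ := GRing.Lalgebra_isAlgebra.Build K grpalg conv_scalerAr.

Lemma grpalgM u v k : (u * v) k = \sum_(h : Z22) u h * v (k - h).
Proof. by rewrite ffunE. Qed.

Lemma singleE g a k : single g a k = if k == g then a else 0.
Proof. by rewrite ffunE. Qed.

Lemma singleM g h a b : single g a * single h b = single (g + h) (a * b).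
Proof.
apply/ffunP => k; rewrite grpalgM (bigD1 g) //= big1 => [|l /negPf nl].
  rewrite !singleE eqxx subr_eq [h + g]addrC addr0.
  by case: ifP => // _; rewrite mulr0.
by rewrite singleE nl mul0r.
Qed.

Lemma singleZ g (x : K) a : x *: single g a = single g (x *: a).
Proof. by apply/ffunP => k; rewrite !ffunE; case: ifP; rewrite ?scaler0. Qed.

Lemma single0 g : single g 0 = 0.
Proof. by apply/ffunP => k; rewrite !ffunE; case: ifP. Qed.

Definition total u : A := \sum_(g : Z22) u g.

Lemma total_single g a : total (single g a) = a.
Proof.
rewrite /total (bigD1 g) //= big1 => [|h /negPf nh]; rewrite singleE ?nh //.
by rewrite eqxx addr0.
Qed.

Lemma totalM u v : total (u * v) = total u * total v.
Proof.
rewrite /total mulr_suml; under eq_bigr do rewrite grpalgM.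
rewrite exchange_big; apply: eq_bigr => h _; rewrite mulr_sumr.
rewrite (reindex_inj (addrI h)); apply: eq_bigr => k _.
by rewrite addrC addrA addNr add0r.
Qed.

End GroupAlgebra.

Inductive gen := gen_x | gen_xV | gen_xi | gen_theta | gen_z.

Definition gdeg (i : gen) : Z22 :=
  match i with
  | gen_x | gen_xV => (0, 0)
  | gen_xi => (0, 1)
  | gen_theta => (1, 0)
  | gen_z => (1, 1)
  end.

(* xV stands for x^-1. Aq is the quotient of the free algebra on gen, realised  *)
(* as terms modulo the axioms of unital associative K-algebras and arel.       *)
Section Presentation.
Variables (K : fieldType) (q : K).

Inductive aterm : Type :=
| AVar (i : gen)
| AZero
| AOne
| AAdd (s t : aterm)
| AOpp (t : aterm)
| AScale (k : K) (t : aterm)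
| AMul (s t : aterm).

HB.instance Definition _ := gen_eqMixin aterm.
HB.instance Definition _ := gen_choiceMixin aterm.

Local Notation tx := (AVar gen_x).
Local Notation txV := (AVar gen_xV).
Local Notation txi := (AVar gen_xi).
Local Notation ttheta := (AVar gen_theta).
Local Notation tz := (AVar gen_z).
Local Infix "∙" := AMul (at level 40).
Local Infix "⋅" := AScale (at level 41).

Inductive arel : aterm -> aterm -> Prop :=
| arel_x_xi : arel (tx ∙ txi) (q ⋅ (txi ∙ tx))
| arel_x_theta : arel (tx ∙ ttheta) (q ⋅ (ttheta ∙ tx))
| arel_x_z : arel (tx ∙ tz) (tz ∙ tx)
| arel_xi2 : arel (txi ∙ txi) AZero
| arel_theta2 : arel (ttheta ∙ ttheta) AZero
| arel_xi_theta : arel (txi ∙ ttheta) (ttheta ∙ txi)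
| arel_xi_z : arel (txi ∙ tz) ((- q^-1) ⋅ (tz ∙ txi))
| arel_theta_z : arel (ttheta ∙ tz) ((- q^-1) ⋅ (tz ∙ ttheta))
| arel_x_xV : arel (tx ∙ txV) AOne
| arel_xV_x : arel (txV ∙ tx) AOne
| arel_xV_xi : arel (txV ∙ txi) (q^-1 ⋅ (txi ∙ txV))
| arel_xV_theta : arel (txV ∙ ttheta) (q^-1 ⋅ (ttheta ∙ txV))
| arel_xV_z : arel (txV ∙ tz) (tz ∙ txV).

Inductive acong : aterm -> aterm -> Prop :=
| acong_rel s t : arel s t -> acong s t
| acong_refl t : acong t t
| acong_sym s t : acong s t -> acong t s
| acong_trans r s t : acong r s -> acong s t -> acong r t
| acong_add s s' t t' : acong s s' -> acong t t' ->
    acong (AAdd s t) (AAdd s' t')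
| acong_opp t t' : acong t t' -> acong (AOpp t) (AOpp t')
| acong_scale k t t' : acong t t' -> acong (AScale k t) (AScale k t')
| acong_mul s s' t t' : acong s s' -> acong t t' ->
    acong (AMul s t) (AMul s' t')
| acong_addA r s t : acong (AAdd r (AAdd s t)) (AAdd (AAdd r s) t)
| acong_addC s t : acong (AAdd s t) (AAdd t s)
| acong_add0 t : acong (AAdd AZero t) t
| acong_addN t : acong (AAdd (AOpp t) t) AZero
| acong_scaleA k l t : acong (AScale k (AScale l t)) (AScale (k * l) t)
| acong_scale1 t : acong (AScale 1 t) t
| acong_scaleDr k s t :
    acong (AScale k (AAdd s t)) (AAdd (AScale k s) (AScale k t))
| acong_scaleDl k l t :
    acong (AScale (k + l) t) (AAdd (AScale k t) (AScale l t))
| acong_mulA r s t : acong (AMul r (AMul s t)) (AMul (AMul r s) t)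
| acong_mul1l t : acong (AMul AOne t) t
| acong_mul1r t : acong (AMul t AOne) t
| acong_mulDl r s t : acong (AMul (AAdd r s) t) (AAdd (AMul r t) (AMul s t))
| acong_mulDr r s t : acong (AMul r (AAdd s t)) (AAdd (AMul r s) (AMul r t))
| acong_scaleAl k s t : acong (AScale k (AMul s t)) (AMul (AScale k s) t)
| acong_scaleAr k s t : acong (AScale k (AMul s t)) (AMul s (AScale k t)).

Section Eval.
Variables (A : algType K) (f : gen -> A).

Fixpoint aeval (t : aterm) : A :=
  match t with
  | AVar i => f i
  | AZero => 0
  | AOne => 1
  | AAdd s t => aeval s + aeval t
  | AOpp t => - aeval t
  | AScale k t => k *: aeval t
  | AMul s t => aeval s * aeval t
  end.

Definition respects_rel : Prop := forall s t, arel s t -> aeval s = aeval t.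

Lemma aevalP : respects_rel -> forall s t, acong s t -> aeval s = aeval t.
Proof.
move=> fP s t; elim=> /=; try congruence.
- exact: fP.
- by move=> *; rewrite addrA.
- by move=> *; rewrite addrC.
- by move=> *; rewrite add0r.
- by move=> *; rewrite addNr.
- by move=> *; rewrite scalerA.
- by move=> *; rewrite scale1r.
- by move=> *; rewrite scalerDr.
- by move=> *; rewrite scalerDl.
- by move=> *; rewrite mulrA.
- by move=> *; rewrite mul1r.
- by move=> *; rewrite mulr1.
- by move=> *; rewrite mulrDl.
- by move=> *; rewrite mulrDr.
- by move=> *; rewrite scalerAl.
- by move=> *; rewrite scalerAr.
Qed.

End Eval.

Definition acongb : rel aterm := fun s t => `[< acong s t >].

Fact acongb_equiv : equiv_class_of acongb.
Proof.
split=> [t|s t|s r t]; first by apply/asboolP; exact: acong_refl.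
  by apply/asboolP/asboolP; exact: acong_sym.
by move=> /asboolP rs /asboolP st; apply/asboolP; exact: acong_trans rs st.
Qed.
Canonical acongb_equivRel := EquivRelPack acongb_equiv.

Definition Aq : Type := {eq_quot acongb}.
HB.instance Definition _ := Choice.on Aq.
HB.instance Definition _ := Quotient.on Aq.

Definition aclass (t : aterm) : Aq := \pi_Aq t.

Lemma aclassP s t : aclass s = aclass t <-> acong s t.
Proof. by split=> [/eqmodP/asboolP|st] //; apply/eqmodP/asboolP. Qed.

Lemma aclass_repr (a : Aq) : aclass (repr a) = a.
Proof. exact: reprK. Qed.

Lemma repr_aclass t : acong (repr (aclass t)) t.
Proof. by apply/aclassP; rewrite aclass_repr. Qed.

Lemma aclassW (P : Aq -> Prop) : (forall t, P (aclass t)) -> forall a, P a.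
Proof. by move=> Pt a; rewrite -(aclass_repr a). Qed.

Definition Aq_add (a b : Aq) := aclass (AAdd (repr a) (repr b)).
Definition Aq_opp (a : Aq) := aclass (AOpp (repr a)).
Definition Aq_scale k (a : Aq) := aclass (AScale k (repr a)).
Definition Aq_mul (a b : Aq) := aclass (AMul (repr a) (repr b)).

Lemma aclassD s t : Aq_add (aclass s) (aclass t) = aclass (AAdd s t).
Proof. by apply/aclassP/acong_add; exact: repr_aclass. Qed.
Lemma aclassN t : Aq_opp (aclass t) = aclass (AOpp t).
Proof. by apply/aclassP/acong_opp; exact: repr_aclass. Qed.
Lemma aclassZ k t : Aq_scale k (aclass t) = aclass (AScale k t).
Proof. by apply/aclassP/acong_scale; exact: repr_aclass. Qed.
Lemma aclassM s t : Aq_mul (aclass s) (aclass t) = aclass (AMul s t).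
Proof. by apply/aclassP/acong_mul; exact: repr_aclass. Qed.

Fact Aq_addA : associative Aq_add.
Proof.
elim/aclassW=> r; elim/aclassW=> s; elim/aclassW=> t.
by rewrite !aclassD; apply/aclassP/acong_addA.
Qed.
Fact Aq_addC : commutative Aq_add.
Proof.
elim/aclassW=> s; elim/aclassW=> t.
by rewrite !aclassD; apply/aclassP/acong_addC.
Qed.
Fact Aq_add0 : left_id (aclass AZero) Aq_add.
Proof. by elim/aclassW=> t; rewrite aclassD; apply/aclassP/acong_add0. Qed.
Fact Aq_addN : left_inverse (aclass AZero) Aq_opp Aq_add.
Proof. by elim/aclassW=> t; rewrite aclassN aclassD; apply/aclassP/acong_addN. Qed.
HB.instance Definition _ :=
  GRing.isZmodule.Build Aq Aq_addA Aq_addC Aq_add0 Aq_addN.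

Lemma Aq_addE (a b : Aq) : a + b = Aq_add a b. Proof. by []. Qed.

Fact Aq_scaleA k l a : Aq_scale k (Aq_scale l a) = Aq_scale (k * l) a.
Proof. by elim/aclassW: a => t; rewrite !aclassZ; apply/aclassP/acong_scaleA. Qed.
Fact Aq_scale1 : left_id 1 Aq_scale.
Proof. by elim/aclassW=> t; rewrite aclassZ; apply/aclassP/acong_scale1. Qed.
Fact Aq_scaleDr : right_distributive Aq_scale +%R.
Proof.
move=> k; elim/aclassW=> s; elim/aclassW=> t.
rewrite !Aq_addE aclassD !aclassZ aclassD; exact/aclassP/acong_scaleDr.
Qed.
Fact Aq_scaleDl a : {morph Aq_scale^~ a : k l / k + l}.
Proof.
elim/aclassW: a => t k l; rewrite !Aq_addE !aclassZ aclassD.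
exact/aclassP/acong_scaleDl.
Qed.
HB.instance Definition _ := GRing.Zmodule_isLmodule.Build K Aq
  Aq_scaleA Aq_scale1 Aq_scaleDr Aq_scaleDl.

Fact Aq_mulA : associative Aq_mul.
Proof.
elim/aclassW=> r; elim/aclassW=> s; elim/aclassW=> t.
by rewrite !aclassM; apply/aclassP/acong_mulA.
Qed.
Fact Aq_mul1l : left_id (aclass AOne) Aq_mul.
Proof. by elim/aclassW=> t; rewrite aclassM; apply/aclassP/acong_mul1l. Qed.
Fact Aq_mul1r : right_id (aclass AOne) Aq_mul.
Proof. by elim/aclassW=> t; rewrite aclassM; apply/aclassP/acong_mul1r. Qed.
Fact Aq_mulDl : left_distributive Aq_mul +%R.
Proof.
elim/aclassW=> r; elim/aclassW=> s; elim/aclassW=> t.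
rewrite !Aq_addE aclassD !aclassM aclassD; exact/aclassP/acong_mulDl.
Qed.
Fact Aq_mulDr : right_distributive Aq_mul +%R.
Proof.
elim/aclassW=> r; elim/aclassW=> s; elim/aclassW=> t.
rewrite !Aq_addE aclassD !aclassM aclassD; exact/aclassP/acong_mulDr.
Qed.

Definition counit_gen (i : gen) : K^o :=
  match i with gen_x | gen_xV => 1 | gen_xi | gen_theta | gen_z => 0 end.

Lemma counit_gen_rel : respects_rel counit_gen.
Proof.
by move=> s t [] /=; rewrite ?mulr0 ?mul0r ?scaler0 ?mulr1.
Qed.

Fact Aq1_neq0 : aclass AOne != aclass AZero.
Proof.
apply/eqP => /aclassP /(aevalP counit_gen_rel) /eqP.
by rewrite oner_eq0.
Qed.

HB.instance Definition _ := GRing.Zmodule_isNzRing.Build Aq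
  Aq_mulA Aq_mul1l Aq_mul1r Aq_mulDl Aq_mulDr Aq1_neq0.

Lemma Aq_mulE (a b : Aq) : a * b = Aq_mul a b. Proof. by []. Qed.
Lemma Aq_scaleE k (a : Aq) : k *: a = Aq_scale k a. Proof. by []. Qed.

Fact Aq_scalerAl k (a b : Aq) : k *: (a * b) = (k *: a) * b.
Proof.
elim/aclassW: a => s; elim/aclassW: b => t.
rewrite !Aq_mulE !Aq_scaleE aclassM !aclassZ aclassM.
exact/aclassP/acong_scaleAl.
Qed.
HB.instance Definition _ := GRing.Lmodule_isLalgebra.Build K Aq Aq_scalerAl.
Fact Aq_scalerAr k (a b : Aq) : k *: (a * b) = a * (k *: b).
Proof.
elim/aclassW: a => s; elim/aclassW: b => t.
rewrite !Aq_mulE !Aq_scaleE aclassM !aclassZ aclassM.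
exact/aclassP/acong_scaleAr.
Qed.
HB.instance Definition _ := GRing.Lalgebra_isAlgebra.Build K Aq Aq_scalerAr.

Definition Aq_gen (i : gen) : Aq := aclass (AVar i).

Lemma AqW (P : Aq -> Prop) :
    (forall i, P (Aq_gen i)) -> P 1 ->
    (forall a b, P a -> P b -> P (a + b)) -> (forall (k : K) a, P a -> P (k *: a)) ->
    (forall a b, P a -> P b -> P (a * b)) -> forall a, P a.
Proof.
move=> Pg P1 PD PZ PM; elim/aclassW.
elim=> [i|||s Ps t Pt|t Pt|k t Pt|s Ps t Pt].
- exact: Pg.
- by have := PZ 0 _ P1; rewrite scale0r.
- exact: P1.
- by rewrite -aclassD; exact: PD.
- by rewrite -aclassN; have := PZ (-1) _ Pt; rewrite scaleN1r.
- by rewrite -aclassZ; exact: PZ.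
- by rewrite -aclassM; exact: PM.
Qed.

Lemma aeval_gen t : aeval Aq_gen t = aclass t.
Proof.
elim: t => [i|||s IHs t IHt|t IHt|k t IHt|s IHs t IHt] //=.
- by rewrite IHs IHt Aq_addE aclassD.
- by rewrite IHt -aclassN.
- by rewrite IHt Aq_scaleE aclassZ.
- by rewrite IHs IHt Aq_mulE aclassM.
Qed.

Lemma Aq_gen_rel : respects_rel Aq_gen.
Proof. by move=> s t st; rewrite !aeval_gen; apply/aclassP/acong_rel. Qed.

Section Lift.
Variables (A : algType K) (f : gen -> A) (fP : respects_rel f).

(* The algebra morphism determined by its values f on the generators.          *)
Definition alift of respects_rel f := fun a : Aq => aeval f (repr a).
Local Notation lift := (alift fP).

Lemma alift_class t : lift (aclass t) = aeval f t.
Proof. exact/(aevalP fP)/repr_aclass. Qed.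

Lemma alift_gen i : lift (Aq_gen i) = f i.
Proof. exact: alift_class. Qed.

Fact alift_linear : linear lift.
Proof.
move=> k; elim/aclassW=> s; elim/aclassW=> t.
by rewrite Aq_addE Aq_scaleE aclassZ aclassD !alift_class.
Qed.

Fact alift_monoid_morphism : monoid_morphism lift.
Proof.
split; first exact: (alift_class AOne).
elim/aclassW=> s; elim/aclassW=> t.
by rewrite Aq_mulE aclassM !alift_class.
Qed.

HB.instance Definition _ := GRing.isLinear.Build K Aq A _ lift alift_linear.
HB.instance Definition _ :=
  GRing.isMonoidMorphism.Build Aq A lift alift_monoid_morphism.
End Lift.

End Presentation.

Section QuantumSuperplane.
Variables (K : fieldType) (q : K).
Local Notation A := (Aq q).

Definition Aq_x : A := Aq_gen q gen_x.
Definition Aq_xV : A := Aq_gen q gen_xV.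
Definition Aq_xi : A := Aq_gen q gen_xi.
Definition Aq_theta : A := Aq_gen q gen_theta.
Definition Aq_z : A := Aq_gen q gen_z.

Definition grading_gen (i : gen) : grpalg A := single (gdeg i) (Aq_gen q i).

Lemma grading_gen_rel : respects_rel q grading_gen.
Proof.
move=> s t st; have := Aq_gen_rel st; case: st => /=;
  rewrite /grading_gen !singleM ?singleZ => -> //;
  rewrite ?single0 //; congr single; exact/eqP.
Qed.

Definition Aq_grading : A -> grpalg A := alift grading_gen_rel.
HB.instance Definition _ :=
  GRing.LRMorphism.copy Aq_grading (alift grading_gen_rel).

Definition Aq_proj (g : Z22) (a : A) : A := Aq_grading a g.

Lemma Aq_proj_gen g i : Aq_proj g (Aq_gen q i) =
  if g == gdeg i then Aq_gen q i else 0.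
Proof. by rewrite /Aq_proj /Aq_grading alift_gen singleE. Qed.

Fact Aq_proj_linear g : linear (Aq_proj g).
Proof. by move=> k a b; rewrite /Aq_proj linearP !ffunE. Qed.

Lemma Aq_proj_mul g a b :
  Aq_proj g (a * b) = \sum_(h : Z22) Aq_proj h a * Aq_proj (g - h) b.
Proof. by rewrite /Aq_proj rmorphM grpalgM. Qed.

HB.instance Definition _ g :=
  GRing.isLinear.Build K A A _ (Aq_proj g) (Aq_proj_linear g).

Lemma Aq_proj_one g : Aq_proj g 1 = if g == 0 then 1 else 0.
Proof. by rewrite /Aq_proj rmorph1 singleE. Qed.

Fact Aq_proj1 : Aq_proj 0 1 = 1.
Proof. by rewrite Aq_proj_one eqxx. Qed.

Fact sum_Aq_proj a : \sum_(g : Z22) Aq_proj g a = a.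
Proof.
elim/AqW: a => [i||a b IHa IHb|k a IHa|a b IHa IHb].
- rewrite (bigD1 (gdeg i)) //= big1 => [|g /negPf ng].
    by rewrite Aq_proj_gen eqxx addr0.
  by rewrite Aq_proj_gen ng.
- rewrite (bigD1 0) //= big1 => [|g /negPf ng].
    by rewrite Aq_proj1 addr0.
  by rewrite Aq_proj_one ng.
- by under eq_bigr do rewrite linearD; rewrite big_split /= IHa IHb.
- by under eq_bigr do rewrite linearZ; rewrite /= -scaler_sumr IHa.
- rewrite -[RHS](f_equal2 *%R IHa IHb) -[LHS]/(total (Aq_grading (a * b))).
  by rewrite rmorphM totalM.
Qed.

Fact Aq_proj_proj g h a :
  Aq_proj g (Aq_proj h a) = if g == h then Aq_proj h a else 0.
Proof.
elim/AqW: a g h => [i||a b IHa IHb|k a IHa|a b IHa IHb] g h.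
- rewrite (Aq_proj_gen h); case: (eqVneq h (gdeg i)) => [->|_].
    exact: Aq_proj_gen.
  by rewrite linear0; case: ifP.
- rewrite (Aq_proj_one h); case: (eqVneq h 0) => [->|_].
    exact: Aq_proj_one.
  by rewrite linear0; case: ifP.
- by rewrite !linearD /= IHa IHb; case: ifP; rewrite ?addr0.
- by rewrite !linearZ /= IHa; case: ifP; rewrite ?scaler0.
- rewrite Aq_proj_mul linear_sum /=.
  have E k : Aq_proj g (Aq_proj k a * Aq_proj (h - k) b) =
      if g == h then Aq_proj k a * Aq_proj (h - k) b else 0.
    rewrite Aq_proj_mul (bigD1 k) //= big1 => [|l /negPf nl].
      rewrite IHa IHb eqxx addr0 (inj_eq (addIr (- k))).
      by case: eqP => // _; rewrite mulr0.
    by rewrite IHa nl mul0r.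
  under eq_bigr do rewrite E.
  by case: eqP => // _; rewrite big1.
Qed.

Fact Aq_projM g h a b :
  Aq_proj (g + h) (Aq_proj g a * Aq_proj h b) = Aq_proj g a * Aq_proj h b.
Proof.
rewrite Aq_proj_mul (bigD1 g) //= big1 => [|l /negPf nl].
  by rewrite !Aq_proj_proj eqxx [g + h]addrC addrK eqxx addr0.
by rewrite Aq_proj_proj nl mul0r.
Qed.

HB.instance Definition _ := Algebra_isZ22Graded.Build K (Aq q)
  Aq_proj_linear sum_Aq_proj Aq_proj_proj Aq_proj1 Aq_projM.

Lemma homog_gen i : homog (gdeg i) (Aq_gen q i).
Proof. by have := Aq_proj_gen (gdeg i) i; rewrite eqxx. Qed.

End QuantumSuperplane.

Section Comultiplication.
Variables (K : fieldType) (q : K).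
Local Notation A := (Aq q).
Local Notation x := (Aq_x q).
Local Notation xV := (Aq_xV q).
Local Notation ξ := (Aq_xi q).
Local Notation θ := (Aq_theta q).
Local Notation z := (Aq_z q).

Lemma Aq_x_xi : x * ξ = q *: (ξ * x). Proof. exact: (Aq_gen_rel (arel_x_xi q)). Qed.
Lemma Aq_x_theta : x * θ = q *: (θ * x).
Proof. exact: (Aq_gen_rel (arel_x_theta q)). Qed.
Lemma Aq_x_z : x * z = z * x. Proof. exact: (Aq_gen_rel (arel_x_z q)). Qed.
Lemma Aq_xi2 : ξ * ξ = 0. Proof. exact: (Aq_gen_rel (arel_xi2 q)). Qed.
Lemma Aq_theta2 : θ * θ = 0. Proof. exact: (Aq_gen_rel (arel_theta2 q)). Qed.
Lemma Aq_xi_theta : ξ * θ = θ * ξ. Proof. exact: (Aq_gen_rel (arel_xi_theta q)). Qed.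
Lemma Aq_xi_z : ξ * z = - q^-1 *: (z * ξ). Proof. exact: (Aq_gen_rel (arel_xi_z q)). Qed.
Lemma Aq_theta_z : θ * z = - q^-1 *: (z * θ).
Proof. exact: (Aq_gen_rel (arel_theta_z q)). Qed.
Lemma Aq_x_xV : x * xV = 1. Proof. exact: (Aq_gen_rel (arel_x_xV q)). Qed.
Lemma Aq_xV_x : xV * x = 1. Proof. exact: (Aq_gen_rel (arel_xV_x q)). Qed.
Lemma Aq_xV_xi : xV * ξ = q^-1 *: (ξ * xV). Proof. exact: (Aq_gen_rel (arel_xV_xi q)). Qed.
Lemma Aq_xV_theta : xV * θ = q^-1 *: (θ * xV).
Proof. exact: (Aq_gen_rel (arel_xV_theta q)). Qed.
Lemma Aq_xV_z : xV * z = z * xV. Proof. exact: (Aq_gen_rel (arel_xV_z q)). Qed.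

(* When q = 0 the relations force ξ = θ = 0, so these hold for every q.        *)
Lemma Aq_qVq_xi : q^-1 *: (x * ξ) = ξ * x.
Proof.
have [q0|q0] := eqVneq q 0; last by rewrite Aq_x_xi scalerA mulVf ?scale1r.
have -> : ξ = 0 by rewrite -[ξ]mul1r -Aq_xV_x -mulrA Aq_x_xi q0 scale0r mulr0.
by rewrite mulr0 mul0r scaler0.
Qed.
Lemma Aq_qVq_theta : q^-1 *: (x * θ) = θ * x.
Proof.
have [q0|q0] := eqVneq q 0; last by rewrite Aq_x_theta scalerA mulVf ?scale1r.
have -> : θ = 0 by rewrite -[θ]mul1r -Aq_xV_x -mulrA Aq_x_theta q0 scale0r mulr0.
by rewrite mulr0 mul0r scaler0.
Qed.

Definition comul_gen (i : gen) : A ⊗ A :=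
  match i with
  | gen_x => x ⊗ x
  | gen_xV => xV ⊗ xV
  | gen_xi => x ⊗ ξ + ξ ⊗ x
  | gen_theta => x ⊗ θ + θ ⊗ x
  | gen_z => x ⊗ z + z ⊗ x
  end.

Lemma tens_genM i j (a d : A) :
  (a ⊗ Aq_gen q i) * (Aq_gen q j ⊗ d) =
  ksign K (gdeg i) (gdeg j) *: ((a * Aq_gen q j) ⊗ (Aq_gen q i * d)).
Proof. by apply: tensM; exact: homog_gen. Qed.

Lemma ksign_gen i j : ksign K (gdeg i) (gdeg j) =
  match i, j with
  | gen_xi, gen_xi | gen_theta, gen_theta | gen_xi, gen_z | gen_theta, gen_z
  | gen_z, gen_xi | gen_z, gen_theta => -1
  | _, _ => 1
  end.
Proof. by case: i; case: j. Qed.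

Lemma comul_gen_rel : respects_rel q comul_gen.
Proof.
have mE := (mulrDl, mulrDr, tens_genM, ksign_gen, scale1r, scaleN1r).
move=> s t [] /=; rewrite /comul_gen !mE -/x -/xV -/ξ -/θ -/z.
- by rewrite Aq_x_xi pureZl pureZr scalerDr.
- by rewrite Aq_x_theta pureZl pureZr scalerDr.
- by rewrite Aq_x_z.
- by rewrite Aq_xi2 linear0l linear0r Aq_x_xi pureZl pureZr add0r addr0 addNr.
- by rewrite Aq_theta2 linear0l linear0r Aq_x_theta pureZl pureZr add0r addr0 addNr.
- rewrite Aq_xi_theta Aq_x_xi Aq_x_theta !pureZl !pureZr.
  by rewrite addrACA.
- rewrite Aq_xi_z Aq_x_z !pureZl !pureZr addrACA !scalerDr.
  have -> : - q^-1 *: - ((x * ξ) ⊗ (z * x)) = (ξ * x) ⊗ (z * x).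
    by rewrite scalerN scaleNr opprK -pureZl Aq_qVq_xi.
  have -> // : - q^-1 *: ((z * x) ⊗ (x * ξ)) = - ((z * x) ⊗ (ξ * x)).
  by rewrite scaleNr -pureZr Aq_qVq_xi.
- rewrite Aq_theta_z Aq_x_z !pureZl !pureZr addrACA !scalerDr.
  have -> : - q^-1 *: - ((x * θ) ⊗ (z * x)) = (θ * x) ⊗ (z * x).
    by rewrite scalerN scaleNr opprK -pureZl Aq_qVq_theta.
  have -> // : - q^-1 *: ((z * x) ⊗ (x * θ)) = - ((z * x) ⊗ (θ * x)).
  by rewrite scaleNr -pureZr Aq_qVq_theta.
- by rewrite Aq_x_xV.
- by rewrite Aq_xV_x.
- by rewrite Aq_xV_x Aq_x_xV Aq_xV_xi pureZl pureZr scalerDr.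
- by rewrite Aq_xV_x Aq_x_xV Aq_xV_theta pureZl pureZr scalerDr.
- by rewrite Aq_xV_x Aq_x_xV Aq_xV_z.
Qed.

Definition Aq_comul : A -> A ⊗ A := alift comul_gen_rel.
HB.instance Definition _ := GRing.LRMorphism.copy Aq_comul (alift comul_gen_rel).

Definition Aq_counit : A -> K^o := alift (@counit_gen_rel K q).
HB.instance Definition _ :=
  GRing.LRMorphism.copy Aq_counit (alift (@counit_gen_rel K q)).

Lemma Aq_comul_gen i : Aq_comul (Aq_gen q i) = comul_gen i.
Proof. exact: alift_gen. Qed.

Lemma Aq_counit_gen i : Aq_counit (Aq_gen q i) = counit_gen K i.
Proof. exact: alift_gen. Qed.

End Comultiplication.

Arguments Aq_comul {K} q _.
Arguments Aq_counit {K} q _.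

(* Main.v *)
(** All the identities required hold on generators by direct computation. The
    maps [Delta], [(Delta ⊗ id) Delta], the flip and so on are morphisms of
    algebras for the graded tensor product, so such identities propagate from
    generators to all of [Aq q]. A graded antihomomorphism is a morphism into
    the graded opposite algebra, with product [(-1)^<g, h> b a], so the antipode
    exists as soon as the prescribed values satisfy the relations there. *)

Require Import Defs.
From mathcomp Require Import all_boot all_order all_algebra.
From HB Require Import structures.
From mathcomp Require Import sesquilinear.
From mathcomp Require Import reals complex ring.

Import GRing.Theory.
Local Open Scope ring_scope.

Set Implicit Arguments.
Unset Strict Implicit.
Unset Printing Implicit Defensive.

(** * Homogeneous elements and components of a product *)

Section GradedAlgebra.
Variables (K : fieldType) (A : z22AlgType K).
Implicit Types (a b : A) (g h : Z22).

Lemma homog0 g : homog g (0 : A).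
Proof. by rewrite /homog linear0. Qed.

Lemma homogN g a : homog g a -> homog g (- a).
Proof. by rewrite -scaleN1r; exact: homogZ. Qed.

(** Reduces an additive property to homogeneous elements, on which all signs are explicit. The empty
    sum is covered because 0 is homogeneous. *)
Lemma homogW (P : A -> Prop) :
    (forall g a, homog g a -> P a) -> (forall a b, P a -> P b -> P (a + b)) ->
  forall a, P a.
Proof.
move=> Ph PD a; rewrite -(sum_gproj a); elim/big_ind: _ => //.
  exact: (Ph 0 _ (homog0 0)).
by move=> g _; exact: (Ph g _ (homog_gproj g a)).
Qed.

(** Both sides are biadditive. For a and b homogeneous of degrees k and l, only the term h = k
    survives, and it is nonzero at most when g = k + l. *)
Lemma gprojM_sum g a b :
  gproj g (a * b) = \sum_(h : Z22) gproj h a * gproj (g - h) b.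
Proof.
elim/homogW: a => [k a ka|a a' IH IH']; last first.
  rewrite mulrDl linearD /= IH IH' -big_split /=.
  by apply: eq_bigr => h _; rewrite linearD mulrDl.
elim/homogW: b => [l b lb|b b' IH IH']; last first.
  rewrite mulrDr linearD /= IH IH' -big_split /=.
  by apply: eq_bigr => h _; rewrite linearD mulrDr.
rewrite (bigD1 k) //= big1 ?addr0 => [|h /negPf hk]; last first.
  by rewrite (gproj_homog _ ka) hk mul0r.
rewrite (gproj_homog _ (homogM ka lb)) ka (gproj_homog _ lb) subr_eq addrC.
by case: eqP => // _; rewrite mulr0.
Qed.

End GradedAlgebra.

(** * Multiplicativity of the structural maps between graded tensor products *)

Section TensorMorphisms.
Variable K : fieldType.

Lemma homog_pure (A B : z22AlgType K) g h (a : A) (b : B) :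
  homog g a -> homog h b -> homog (g + h) (a ⊗ b).
Proof.
by move=> ga hb; rewrite /homog [LHS](tproj_homog _ ga hb) eqxx.
Qed.

Lemma htens3W (A B C : z22AlgType K) (P : tensor (tensor A B) C -> Prop) :
    (forall g h k a b c, homog g a -> homog h b -> homog k c -> P ((a ⊗ b) ⊗ c)) ->
    (forall s t, P s -> P t -> P (s + t)) ->
    (forall (x : K) t, P t -> P (x *: t)) ->
  forall t, P t.
Proof.
move=> Pp PD PZ.
(* Zero is a scalar multiple of a pure tensor, so it needs no hypothesis of its own. *)
have P0 : P 0.
  rewrite -(scale0r (0 ⊗ 0 ⊗ 0)); apply: PZ.
  by apply: (Pp 0 0 0); exact: homog0.
apply: tensW => // u c; elim/htensW: u => [g h a b ga hb||s t Ps Pt|x t Pt].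
- elim/homogW: c => [k c kc|c c' Pc Pc']; first exact: Pp ga hb kc.
  by rewrite pureDr; exact: PD.
- by rewrite linear0l.
- by rewrite pureDl; exact: PD.
- by rewrite pureZl; exact: PZ.
Qed.

Lemma tens_monoid_morphism (A B : z22AlgType K) (C : algType K)
    (f : {linear (A ⊗ B)%type -> C}) :
    f 1 = 1 ->
    (forall g h k l a b c d,
       homog g a -> homog h b -> homog k c -> homog l d ->
     f ((a ⊗ b) * (c ⊗ d)) = f (a ⊗ b) * f (c ⊗ d)) ->
  monoid_morphism f.
Proof.
move=> f1 fM; split=> // s t; elim/htensW: s => [g h a b ga hb||s s' IH IH'|x s IH].
- elim/htensW: t => [k l c d kc ld||t t' IH IH'|x t IH].
  + exact: fM ga hb kc ld.
  + by rewrite mulr0 linear0 mulr0.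
  + by rewrite mulrDr !linearD /= IH IH' mulrDr.
  + by rewrite -scalerAr !linearZ /= IH -scalerAr.
- by rewrite mul0r linear0 mul0r.
- by rewrite mulrDl !linearD /= IH IH' mulrDl.
- by rewrite -scalerAl !linearZ /= IH -scalerAl.
Qed.

(** Since f and g preserve degrees, the sign in a product of pure tensors is the same before and
    after applying them. *)
Lemma tens_map_morphism (A B A' B' : z22AlgType K)
    (f : {linear A -> A'}) (g : {linear B -> B'}) :
  z22_morphism f -> z22_morphism g -> monoid_morphism (tens_map f g).
Proof.
move=> [[f1 fM] fh] [[g1 gM] gh].
apply: tens_monoid_morphism => [|g' h k l a b c d aP bP cP dP].
  by rewrite [LHS]tens_map_pure f1 g1.
rewrite (tensM _ _ bP cP) linearZ /= !tens_map_pure fM gM.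
by rewrite (tensM _ _ (gh _ _ bP) (fh _ _ cP)).
Qed.

(** Both bracketings give the same sign by biadditivity of the pairing: <k, g' + h'> + <h, g'> = <h
    + k, g'> + <k, h'>. *)
Lemma tens_assoc_morphism (A B C : z22AlgType K) :
  monoid_morphism (@tens_assoc K A B C).
Proof.
split=> [|s t]; first by rewrite [LHS]tens_assoc_pure.
elim/htens3W: s => [g h k a b c ga hb kc|s s' IH IH'|x s IH]; first last.
- by rewrite -scalerAl !linearZ /= IH -scalerAl.
- by rewrite mulrDl !linearD /= IH IH' mulrDl.
elim/htens3W: t => [g' h' k' a' b' c' ga' hb' kc'|t t' IH IH'|x t IH]; first last.
- by rewrite -scalerAr !linearZ /= IH -scalerAr.
- by rewrite mulrDr !linearD /= IH IH' mulrDr.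
rewrite (tensM _ _ kc (homog_pure ga' hb')) (tensM _ _ hb ga') !linearZ /=.
rewrite pureZl linearZ /= !tens_assoc_pure.
rewrite (tensM _ _ (homog_pure hb kc) ga') (tensM _ _ kc hb') pureZr.
rewrite !scalerA ksignDl ksignDr; congr (_ *: _); ring.
Qed.

(** No sign appears, the unit having degree 0. *)
Lemma pure1l_morphism (A B : z22AlgType K) :
  monoid_morphism (fun b : B => (1 : A) ⊗ b).
Proof.
split=> // a b; elim/homogW: a => [g a ga|a a' IH IH'].
  by rewrite (tensM _ _ ga (homog1 A)) ksign0r scale1r mul1r.
by rewrite mulrDl !pureDr IH IH' mulrDl.
Qed.

Lemma pure1r_morphism (A B : z22AlgType K) :
  monoid_morphism (fun a : A => a ⊗ (1 : B)).
Proof.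
split=> // a b; elim/homogW: b => [g b gb|b b' IH IH'].
  by rewrite (tensM _ _ (homog1 B) gb) ksign0l scale1r mulr1.
by rewrite mulrDr !pureDl IH IH' mulrDr.
Qed.

Lemma swap_morphism (A B : z22AlgType K) : monoid_morphism (@swap K A B).
Proof.
apply: tens_monoid_morphism => [|g h k l a b c d ga hb kc ld].
  by rewrite [LHS](swap_homog (homog1 A) (homog1 B)) ksign0l scale1r.
rewrite (tensM _ _ hb kc) linearZ /= (swap_homog (homogM ga kc) (homogM hb ld)).
rewrite (swap_homog ga hb) (swap_homog kc ld) -scalerAl -scalerAr.
rewrite (tensM _ _ ga ld) !scalerA !(ksignDl, ksignDr) (ksignC K k h).
(* The left side contains the sign of h and k twice, once from the product and once from the flip,
   so its square 1 is inserted on the right. *)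
congr (_ *: _); rewrite -[RHS]mul1r -(ksignK K h k); ring.
Qed.

End TensorMorphisms.

(** * The graded opposite algebra *)

Section GradedOpposite.
Variables (K : fieldType) (A : z22AlgType K).
Implicit Types (a b c : A) (g h : Z22).

(** Going through [swap] extends the signed reversed product bilinearly to inhomogeneous
    elements. *)
Definition gop_mul a b : A := tens_mul (swap (a ⊗ b)).

Lemma gop_mulE g h a b : homog g a -> homog h b ->
  gop_mul a b = ksign K g h *: (b * a).
Proof.
by move=> ga hb; rewrite /gop_mul (swap_homog ga hb) linearZ /= tens_mul_pure.
Qed.

Fact gop_mulDl : left_distributive gop_mul +%R.
Proof. by move=> a b c; rewrite /gop_mul pureDl !linearD. Qed.
Fact gop_mulDr : right_distributive gop_mul +%R.
Proof. by move=> a b c; rewrite /gop_mul pureDr !linearD. Qed.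
Fact gop_scalerAl (k : K) a b : k *: gop_mul a b = gop_mul (k *: a) b.
Proof. by rewrite /gop_mul pureZl !linearZ. Qed.
Fact gop_scalerAr (k : K) a b : k *: gop_mul a b = gop_mul a (k *: b).
Proof. by rewrite /gop_mul pureZr !linearZ. Qed.

Lemma homog_gop_mul g h a b :
  homog g a -> homog h b -> homog (g + h) (gop_mul a b).
Proof.
by move=> ga hb; rewrite (gop_mulE ga hb) addrC; apply/homogZ/homogM.
Qed.

(** On homogeneous elements the two signs agree: <g, h + k> + <h, k> = <g + h, k> + <g, h>. *)
Fact gop_mulA : associative gop_mul.
Proof.
move=> a b c.
elim/homogW: a => [g a ga|a a' IH IH']; last by rewrite !gop_mulDl IH IH'.
elim/homogW: b => [h b hb|b b' IH IH']; last first.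
  by rewrite gop_mulDl !gop_mulDr gop_mulDl IH IH'.
elim/homogW: c => [k c kc|c c' IH IH']; last by rewrite !gop_mulDr IH IH'.
rewrite (gop_mulE ga (homog_gop_mul hb kc)) (gop_mulE hb kc).
rewrite (gop_mulE (homog_gop_mul ga hb) kc) (gop_mulE ga hb).
rewrite -scalerAl -scalerAr !scalerA mulrA ksignDl ksignDr.
by congr (_ *: _); ring.
Qed.

Fact gop_mul1l : left_id 1 gop_mul.
Proof.
elim/homogW=> [g a ga|a b IHa IHb]; last by rewrite gop_mulDr IHa IHb.
by rewrite (gop_mulE (homog1 A) ga) ksign0l scale1r mulr1.
Qed.

Fact gop_mul1r : right_id 1 gop_mul.
Proof.
elim/homogW=> [g a ga|a b IHa IHb]; last by rewrite gop_mulDl IHa IHb.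
by rewrite (gop_mulE ga (homog1 A)) ksign0r scale1r mul1r.
Qed.

(** A separate name for the same vector space, so that it can carry the opposite product as its ring
    structure. *)
Definition gop : Type := A.
HB.instance Definition _ := GRing.Lmodule.on gop.
HB.instance Definition _ := GRing.Zmodule_isNzRing.Build gop
  gop_mulA gop_mul1l gop_mul1r gop_mulDl gop_mulDr (oner_neq0 A).
HB.instance Definition _ := GRing.Lmodule_isLalgebra.Build K gop gop_scalerAl.
HB.instance Definition _ := GRing.Lalgebra_isAlgebra.Build K gop gop_scalerAr.

Fact gop_gprojM g h a b :
  gproj (g + h) (gop_mul (gproj g a) (gproj h b)) = gop_mul (gproj g a) (gproj h b).
Proof. by apply: homog_gop_mul; exact: homog_gproj. Qed.

HB.instance Definition _ := Algebra_isZ22Graded.Build K gop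
  (@gproj_is_linear K A) (@sum_gproj K A) (@gproj_gproj K A) (@gproj1 K A)
  gop_gprojM.

End GradedOpposite.

(** * Graded antihomomorphisms and convolution with the identity *)

Section Antihomomorphisms.
Variables (K : fieldType) (A : z22AlgType K).

Lemma gop_antihom (S : {linear A -> A}) :
  z22_morphism (S : A -> gop A) -> z22_antihom S.
Proof.
move=> [[S1 SM] Sh]; split=> // g h a b ga hb.
by rewrite [LHS]SM; apply: gop_mulE; exact: Sh.
Qed.

Variables (S : {linear A -> A}) (SP : z22_antihom S).

(** Reversing twice restores the order, and the sign occurs twice because S preserves degrees. *)
Lemma antihom_comp_morphism : monoid_morphism (S \o S).
Proof.
have [Sh S1 SM] := SP; split=> [|a b] /=; first by rewrite !S1.
elim/homogW: a => [g a ga|a a' IH IH']; last first.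
  by rewrite mulrDl !linearD /= IH IH' mulrDl.
elim/homogW: b => [h b hb|b b' IH IH']; last first.
  by rewrite mulrDr !linearD /= IH IH' mulrDr.
rewrite (SM _ _ _ _ ga hb) linearZ /= (SM _ _ _ _ (Sh _ _ hb) (Sh _ _ ga)).
by rewrite scalerA ksignC ksignK scale1r.
Qed.

Definition convl : tensor A A -> A := @tens_mul K A \o tens_map S idfun.
Definition convr : tensor A A -> A := @tens_mul K A \o tens_map idfun S.
HB.instance Definition _ :=
  GRing.Linear.copy convl (@tens_mul K A \o tens_map S idfun).
HB.instance Definition _ :=
  GRing.Linear.copy convr (@tens_mul K A \o tens_map idfun S).

Lemma convl_pure a b : convl (a ⊗ b) = S a * b.
Proof. by rewrite /convl /= tens_map_pure tens_mul_pure. Qed.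

Lemma convr_pure a b : convr (a ⊗ b) = a * S b.
Proof. by rewrite /convr /= tens_map_pure tens_mul_pure. Qed.

(** Lets the left antipode identity pass from two elements to their product, although [convl] need
    not be multiplicative. *)
Lemma convlM s t (k : K) : convl s = k%:A -> convl (s * t) = k *: convl t.
Proof.
have [Sh _ SM] := SP.
(* For s = a ⊗ b the value is, up to sign, S(c) S(a) b d: [convl s] stands between S(c) and d, with
   the sign of the opposite product. When it is a scalar, it slides out. *)
suff E c d : convl (s * (c ⊗ d)) = gop_mul (convl s) (S c) * d.
  move=> sk; elim/tensW: t => [c d||t t' IH IH'|x t IH].
  - rewrite E sk -gop_scalerAl gop_mul1l convl_pure.
    by rewrite scalerAl.
  - by rewrite mulr0 !linear0.
  - by rewrite mulrDr !linearD /= IH IH'.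
  - by rewrite -scalerAr !linearZ /= IH !scalerA mulrC.
elim/htensW: s => [g h a b ga hb||s s' IH IH'|x s IH].
- elim/homogW: c => [k' c kc|c c' IH IH']; last first.
    by rewrite pureDl mulrDr !linearD /= IH IH' gop_mulDr mulrDl.
  rewrite (tensM _ _ hb kc) linearZ /= !convl_pure.
  rewrite (gop_mulE (homogM (Sh _ _ ga) hb) (Sh _ _ kc)) (SM _ _ _ _ ga kc) /=.
  by rewrite -!scalerAl !scalerA ksignDl mulrC !mulrA.
- by rewrite mul0r !linear0 /gop_mul linear0l !linear0 mul0r.
- by rewrite mulrDl !linearD /= IH IH' gop_mulDl mulrDl.
- by rewrite -scalerAl !linearZ /= IH -gop_scalerAl scalerAl.
Qed.

Lemma convrM s t (k : K) : convr t = k%:A -> convr (s * t) = k *: convr s.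
Proof.
have [Sh _ SM] := SP.
(* Mirror image: for t = c ⊗ d the value is, up to sign, a c S(d) S(b), so here it is [convr t] that
   stands in the middle. *)
suff E a b : convr ((a ⊗ b) * t) = a * gop_mul (S b) (convr t).
  move=> tk; elim/tensW: s => [a b||s s' IH IH'|x s IH].
  - rewrite E tk -gop_scalerAr gop_mul1r convr_pure.
    by rewrite scalerAr.
  - by rewrite mul0r !linear0.
  - by rewrite mulrDl !linearD /= IH IH'.
  - by rewrite -scalerAl !linearZ /= IH !scalerA mulrC.
elim/htensW: t => [g h c d gc hd||t t' IH IH'|x t IH].
- elim/homogW: b => [k' b kb|b b' IH IH']; last first.
    by rewrite pureDr mulrDl !linearD /= IH IH' gop_mulDl mulrDr.
  rewrite (tensM _ _ kb gc) linearZ /= !convr_pure.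
  rewrite (gop_mulE (Sh _ _ kb) (homogM gc (Sh _ _ hd))) (SM _ _ _ _ kb hd) /=.
  by rewrite -!scalerAr !scalerA ksignDr !mulrA.
- by rewrite mulr0 !linear0 /gop_mul linear0r !linear0 mulr0.
- by rewrite mulrDr !linearD /= IH IH' gop_mulDr mulrDr.
- by rewrite -scalerAr !linearZ /= IH -gop_scalerAr scalerAr.
Qed.

End Antihomomorphisms.

(** * Reduction to generators, and the bialgebra structure *)

Section Generators.
Variables (K : fieldType) (q : K).
Local Notation A := (Aq q).

(** The morphism properties are hypotheses on plain functions, so that composites and maps such as a
    ↦ a ⊗ 1 can be compared directly. *)
Lemma Aq_morphism_ext (B : algType K) (f g : A -> B) :
    linear f -> linear g -> monoid_morphism f -> monoid_morphism g ->
  (forall i, f (Aq_gen q i) = g (Aq_gen q i)) -> f =1 g.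
Proof.
move=> fL gL [f1 fM] [g1 gM] fg.
pose F : {linear A -> B} := HB.pack f (GRing.isLinear.Build K A B _ f fL).
pose G : {linear A -> B} := HB.pack g (GRing.isLinear.Build K A B _ g gL).
elim/AqW=> [i||a b IHa IHb|k a IHa|a b IHa IHb] //.
- by rewrite f1 g1.
- by rewrite [LHS](linearD F) [RHS](linearD G) /= IHa IHb.
- by rewrite [LHS](linearZ_LR F) [RHS](linearZ_LR G) /= IHa.
- by rewrite fM gM IHa IHb.
Qed.

Lemma Aq_z22_morphism (B : z22AlgType K) (f : {linear A -> B}) :
    monoid_morphism f -> (forall i, homog (gdeg i) (f (Aq_gen q i))) ->
  z22_morphism f.
Proof.
move=> [f1 fM] fh; split=> // g a ga.
(* Homogeneity is not suited to induction, a homogeneous element being possibly built from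
   inhomogeneous ones. Commuting with every projection does pass through sums and products. *)
suff fproj h b : gproj h (f b) = f (gproj h b) by rewrite /homog fproj ga.
elim/AqW: b h => [i||b c IHb IHc|k b IHb|b c IHb IHc] h.
- rewrite (gproj_homog _ (fh i)) (gproj_homog _ (homog_gen q i)).
  by case: ifP; rewrite ?linear0.
- rewrite f1 !(gproj_homog _ (homog1 _)) -f1.
  by case: ifP; rewrite ?linear0.
- by rewrite !linearD /= IHb IHc.
- by rewrite !linearZ /= IHb.
- rewrite fM !gprojM_sum linear_sum /=; apply: eq_bigr => k _.
  by rewrite fM IHb IHc.
Qed.

Lemma monoid_morphism_comp (R S T : pzRingType) (f : S -> T) (g : R -> S) :
  monoid_morphism f -> monoid_morphism g -> monoid_morphism (f \o g).
Proof.
by move=> [f1 fM] [g1 gM]; split=> [|a b] /=; rewrite ?g1 ?gM ?f1 ?fM.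
Qed.

Lemma z22_morphism_id (B : z22AlgType K) : z22_morphism (@idfun B).
Proof. by split. Qed.

Lemma Aq_comul_morphism : z22_morphism (Aq_comul q).
Proof.
apply: Aq_z22_morphism => [|i]; first exact: alift_monoid_morphism.
have hg j k : gdeg j + gdeg k == gdeg i ->
    homog (gdeg i) (Aq_gen q j ⊗ Aq_gen q k).
  by move=> /eqP <-; exact: homog_pure (homog_gen q j) (homog_gen q k).
by rewrite /= Aq_comul_gen; case: i hg => hg; try apply: homogD; apply: hg.
Qed.

Lemma Aq_counit_morphism : z22_morphism (Aq_counit q).
Proof.
apply: Aq_z22_morphism => [|i]; first exact: alift_monoid_morphism.
rewrite /= Aq_counit_gen; case: i; try exact: homog0; exact: (homog1 K^o).
Qed.

Lemma Aq_coassociative a :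
  tens_assoc (tens_map (Aq_comul q) idfun (Aq_comul q a)) =
  tens_map idfun (Aq_comul q) (Aq_comul q a).
Proof.
have cM := Aq_comul_morphism; have idM := z22_morphism_id A.
apply: (Aq_morphism_ext
    (f := @tens_assoc K A A A \o (tens_map (Aq_comul q) idfun \o Aq_comul q))
    (g := tens_map idfun (Aq_comul q) \o Aq_comul q)).
- exact: linearP.
- exact: linearP.
- apply: monoid_morphism_comp; first exact: tens_assoc_morphism.
  by apply: monoid_morphism_comp cM.1; exact: tens_map_morphism.
- by apply: monoid_morphism_comp cM.1; exact: tens_map_morphism.
- move=> i /=; rewrite Aq_comul_gen.
  by case: i; rewrite /= ?linearD /= !tens_map_pure /= !Aq_comul_gen /=
    ?pureDl ?pureDr ?linearD /= !tens_assoc_pure ?addrA.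
Qed.

Lemma Aq_counital_left a :
  tens_map (Aq_counit q) idfun (Aq_comul q a) = (1 : K^o) ⊗ a.
Proof.
have cM := Aq_comul_morphism; have eM := Aq_counit_morphism.
have idM := z22_morphism_id A.
apply: (Aq_morphism_ext (B := tensor K^o A)
    (f := tens_map (Aq_counit q) idfun \o Aq_comul q)
    (g := fun a => (1 : K^o) ⊗ a)).
- exact: linearP.
- by move=> k b c; rewrite pureDr pureZr.
- by apply: monoid_morphism_comp cM.1; exact: tens_map_morphism.
- exact: pure1l_morphism.
- move=> i /=; rewrite Aq_comul_gen.
  by case: i; rewrite /= ?linearD /= !tens_map_pure /= !Aq_counit_gen /=
    ?linear0l ?addr0.
Qed.

Lemma Aq_counital_right a :
  tens_map idfun (Aq_counit q) (Aq_comul q a) = a ⊗ (1 : K^o).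
Proof.
have cM := Aq_comul_morphism; have eM := Aq_counit_morphism.
have idM := z22_morphism_id A.
apply: (Aq_morphism_ext (B := tensor A K^o)
    (f := tens_map idfun (Aq_counit q) \o Aq_comul q)
    (g := fun a => a ⊗ (1 : K^o))).
- exact: linearP.
- by move=> k b c; rewrite pureDl pureZl.
- by apply: monoid_morphism_comp cM.1; exact: tens_map_morphism.
- exact: pure1r_morphism.
- move=> i /=; rewrite Aq_comul_gen.
  by case: i; rewrite /= ?linearD /= !tens_map_pure /= !Aq_counit_gen /=
    ?linear0r ?add0r.
Qed.

Lemma Aq_bialgebra : z22_bialgebra (Aq_comul q) (Aq_counit q).
Proof.
split.
- exact: Aq_comul_morphism.
- exact: Aq_counit_morphism.
- exact: Aq_coassociative.
- exact: Aq_counital_left.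
- exact: Aq_counital_right.
Qed.

Lemma Aq_cocommutative : cocommutative (Aq_comul q).
Proof.
have cM := Aq_comul_morphism.
have sE i j : swap (Aq_gen q i ⊗ Aq_gen q j) =
    ksign K (gdeg i) (gdeg j) *: (Aq_gen q j ⊗ Aq_gen q i).
  by apply: swap_homog; exact: homog_gen.
move=> a; apply: (Aq_morphism_ext (f := @swap K A A \o Aq_comul q)
                                  (g := Aq_comul q)).
- exact: linearP.
- exact: linearP.
- exact: monoid_morphism_comp (swap_morphism A A) cM.1.
- exact: cM.1.
(* As x has degree 0, the flip introduces no sign and merely exchanges x ⊗ y and y ⊗ x. *)
- move=> i /=; rewrite Aq_comul_gen.
  by case: i; rewrite /= ?linearD /= !sE !ksign_gen !scale1r // addrC.
Qed.

(** The antipode identities need checking on generators only: in the product case, [convlM] extracts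
    the scalar given by the left factor and [convrM] the one given by the right factor. *)
Lemma Aq_antipode (S : {linear A -> A}) :
    z22_antihom S ->
    (forall i, convl S (comul_gen q i) = (counit_gen K i : K)%:A) ->
    (forall i, convr S (comul_gen q i) = (counit_gen K i : K)%:A) ->
  z22_antipode (Aq_comul q) (Aq_counit q) S.
Proof.
move=> SP Sl Sr; have [_ S1 _] := SP.
have c1 : Aq_comul q 1 = 1 ⊗ 1 := rmorph1 (Aq_comul q).
have cM : {morph Aq_comul q : a b / a * b} := rmorphM (Aq_comul q).
have e1 : Aq_counit q 1 = (1 : K) := rmorph1 (Aq_counit q).
have eM a b : (Aq_counit q (a * b) : K) = Aq_counit q a * Aq_counit q b :=
  rmorphM (Aq_counit q) a b.
split=> // a.
- change (convl S (Aq_comul q a) = (Aq_counit q a : K)%:A).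
  elim/AqW: a => [i||a b IHa IHb|k a IHa|a b IHa IHb].
  + by rewrite Aq_comul_gen Aq_counit_gen Sl.
  + by rewrite c1 e1 convl_pure S1 mul1r scale1r.
  + by rewrite !linearD /= IHa IHb scalerDl.
  + by rewrite !linearZ /= IHa scalerA.
  + by rewrite cM (convlM SP _ IHa) IHb eM scalerA.
- change (convr S (Aq_comul q a) = (Aq_counit q a : K)%:A).
  elim/AqW: a => [i||a b IHa IHb|k a IHa|a b IHa IHb].
  + by rewrite Aq_comul_gen Aq_counit_gen Sr.
  + by rewrite c1 e1 convr_pure S1 mul1r scale1r.
  + by rewrite !linearD /= IHa IHb scalerDl.
  + by rewrite !linearZ /= IHa scalerA.
  + by rewrite cM (convrM SP _ IHb) IHa eM scalerA mulrC.
Qed.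

End Generators.

(** * Construction and properties of the antipode *)

Section Antipode.
Variables (K : fieldType) (q : K) (q_neq0 : q != 0).
Local Notation A := (Aq q).
Local Notation x := (Aq_x q).
Local Notation xV := (Aq_xV q).
Local Notation ξ := (Aq_xi q).
Local Notation θ := (Aq_theta q).
Local Notation z := (Aq_z q).

Definition antipode_gen (i : gen) : A :=
  match i with
  | gen_x => xV
  | gen_xV => x
  | gen_xi => - (xV * ξ * xV)
  | gen_theta => - (xV * θ * xV)
  | gen_z => - (xV * z * xV)
  end.

Lemma homog_antipode_gen i : homog (gdeg i) (antipode_gen i).
Proof.
have hV : homog 0 xV := homog_gen q gen_xV.
have hV2 g a : homog g a -> homog g (- (xV * a * xV)).
  move=> ga; apply: homogN; rewrite -[g]addr0 -[g]add0r.
  exact: homogM (homogM hV ga) hV.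
case: i => /=; [exact: hV|exact: (homog_gen q gen_x)|..]; apply: hV2.
- exact: (homog_gen q gen_xi).
- exact: (homog_gen q gen_theta).
- exact: (homog_gen q gen_z).
Qed.

Lemma gop_mul_gen i j : gop_mul (antipode_gen i) (antipode_gen j) =
  ksign K (gdeg i) (gdeg j) *: (antipode_gen j * antipode_gen i).
Proof. by apply: gop_mulE; exact: homog_antipode_gen. Qed.

(** This is the condition for extending the prescribed values to a morphism into the opposite
    algebra. Each relation is checked by bringing both sides to a common ordered form; moving ξ or θ
    past x^-1 costs a factor q. *)
Lemma antipode_gen_rel : @respects_rel K q (gop A) antipode_gen.
Proof.
have xiV : ξ * xV = q *: (xV * ξ) by rewrite Aq_xV_xi scalerA mulfV ?scale1r.
have thetaV : θ * xV = q *: (xV * θ) by rewrite Aq_xV_theta scalerA mulfV ?scale1r.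
(* Rewriting with these moves powers of x^-1 to the left. *)
have xiVA a : ξ * (xV * a) = q *: (xV * (ξ * a)).
  by rewrite mulrA xiV -scalerAl mulrA.
have thetaVA a : θ * (xV * a) = q *: (xV * (θ * a)).
  by rewrite mulrA thetaV -scalerAl mulrA.
have zVA a : z * (xV * a) = xV * (z * a) by rewrite !mulrA Aq_xV_z.
have xVK a : x * (xV * a) = a by rewrite mulrA Aq_x_xV mul1r.
have VxK a : xV * (x * a) = a by rewrite mulrA Aq_xV_x mul1r.
have M i j : (antipode_gen i : gop A) * (antipode_gen j : gop A) =
    ksign K (gdeg i) (gdeg j) *: (antipode_gen j * antipode_gen i).
  exact: gop_mul_gen.
have E := (xiV, thetaV, esym (Aq_xV_z q), xiVA, thetaVA, zVA, xVK, VxK,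
  Aq_xi2, Aq_theta2, Aq_x_xV, Aq_xV_x).
move=> s t []; cbn [aeval]; rewrite ?M ?ksign_gen ?scale1r ?scaleN1r /=
  ?mulNr ?mulrN ?opprK -?mulrA ?E.
all: do ?rewrite -?scalerAr ?E ?scalerA ?scaleNr ?scalerN ?mulr0 ?scaler0 ?oppr0 //.
all: rewrite ?Aq_xi_theta //.
(* Reordering ξ z as z ξ gives the same monomial on both sides; only the powers of q remain to be
   compared. *)
- rewrite Aq_xi_z -!scalerAr scalerA opprK -scaleNr.
  by congr (_ *: _); field.
- rewrite Aq_theta_z -!scalerAr scalerA opprK -scaleNr.
  by congr (_ *: _); field.
(* In the last three cases a factor x, the image of x^-1, is moved left to cancel a power of
   x^-1. *)
- by rewrite -Aq_qVq_xi -!scalerAr VxK scalerA mulVf // mulfV.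
- by rewrite -Aq_qVq_theta -!scalerAr VxK scalerA mulVf // mulfV.
- by rewrite -Aq_x_z VxK.
Qed.

(** The lift takes values in [gop A], whose underlying space is that of A. *)
Definition Aq_S : A -> A := alift antipode_gen_rel.

Fact Aq_S_linear : linear Aq_S.
Proof. exact: (alift_linear antipode_gen_rel). Qed.
HB.instance Definition _ := GRing.isLinear.Build K A A _ Aq_S Aq_S_linear.

Lemma Aq_S_gen i : Aq_S (Aq_gen q i) = antipode_gen i.
Proof. exact: (alift_gen antipode_gen_rel i). Qed.

Lemma Aq_S_antihom : z22_antihom Aq_S.
Proof.
apply: gop_antihom.
apply: (Aq_z22_morphism (B := gop A) (f := alift antipode_gen_rel)) => [|i].
  exact: alift_monoid_morphism.
by rewrite /= alift_gen; exact: homog_antipode_gen.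
Qed.

(** For y among ξ, θ, z, the two terms cancel: x^-1 y - x^-1 y x^-1 x = 0 on the left, and -x x^-1 y
    x^-1 + y x^-1 = 0 on the right. *)
Lemma Aq_S_antipode : z22_antipode (Aq_comul q) (Aq_counit q) Aq_S.
Proof.
have SE := (Aq_S_gen gen_x : Aq_S x = _, Aq_S_gen gen_xV : Aq_S xV = _,
  Aq_S_gen gen_xi : Aq_S ξ = _, Aq_S_gen gen_theta : Aq_S θ = _,
  Aq_S_gen gen_z : Aq_S z = _).
apply: Aq_antipode Aq_S_antihom _ _ => -[];
  rewrite /= ?linearD /= ?convl_pure ?convr_pure /= !SE /= ?scale0r ?scale1r
    ?Aq_x_xV ?Aq_xV_x //.
all: rewrite ?mulNr ?mulrN -?mulrA ?Aq_xV_x ?mulr1.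
all: rewrite ?[x * (xV * _)]mulrA ?Aq_x_xV ?mul1r ?subrr ?addNr //.
Qed.

Lemma Aq_S_involutive : involutive Aq_S.
Proof.
have [_ _ SM] := Aq_S_antihom.
have hV : homog 0 xV := homog_gen q gen_xV.
have Sx : Aq_S x = xV := Aq_S_gen gen_x.
have SxV : Aq_S xV = x := Aq_S_gen gen_xV.
(* The outer factors have degree 0, so reversal brings no sign; substituting S(a) = -x^-1 a x^-1 for
   a generator then gives back a. *)
have SV g a : homog g a -> Aq_S (- (xV * a * xV)) = - (x * Aq_S a * x).
  move=> ga; rewrite linearN /= (SM _ _ _ _ (homogM hV ga) hV).
  by rewrite (SM _ _ _ _ hV ga) ksign0l ksign0r !scale1r /= SxV mulrA.
apply: (Aq_morphism_ext (f := Aq_S \o Aq_S) (g := idfun)) => //.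
- exact: linearP.
- exact: (antihom_comp_morphism Aq_S_antihom).
move=> i /=; rewrite Aq_S_gen.
case: i => /=; rewrite ?Sx ?SxV //;
  [ rewrite (SV _ _ (homog_gen q gen_xi)) | rewrite (SV _ _ (homog_gen q gen_theta))
  | rewrite (SV _ _ (homog_gen q gen_z)) ];
  by rewrite Aq_S_gen /= mulrN mulNr opprK -!mulrA Aq_xV_x mulr1 mulrA Aq_x_xV mul1r.
Qed.

End Antipode.

(** * The Hopf structure on the quantum superplane *)

Theorem theorem1 (R : realType) (q : R[i]) (q_neq0 : q != 0)
    (q_not_root : forall n : nat, (0 < n)%N -> q ^+ n != 1) :
  exists S : {linear Aq q -> Aq q},
    [/\ z22_hopf (Aq_comul q) (Aq_counit q) S,
        cocommutative (Aq_comul q),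
        involutive S
      & [/\ S (Aq_x q) = Aq_xV q,
            S (Aq_xV q) = Aq_x q,
            S (Aq_xi q) = - (Aq_xV q * Aq_xi q * Aq_xV q),
            S (Aq_theta q) = - (Aq_xV q * Aq_theta q * Aq_xV q)
          & S (Aq_z q) = - (Aq_xV q * Aq_z q * Aq_xV q)]].
Proof.
exists (Aq_S q_neq0); split.
- by split; [exact: Aq_bialgebra | exact: Aq_S_antipode].
- exact: Aq_cocommutative.
- exact: Aq_S_involutive.
- by split; exact: (Aq_S_gen q_neq0).
Qed.
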